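(* Let $A$ be a canonical algebra and let $\mathbb{X}^S$ be the Serre stable moduli stack of $A$-modules with dimension vector $\vec d=\mathbf{1}$ (all entries equal to $1$) and shift parameter $1$. Let $M$ be a $k$-point of $\mathbb{X}^S$, i.e. a Serre stable $A$-module of dimension vector $\mathbf{1}$. Then $M$ is regular semisimple.
   Context: $k$ is an algebraically closed field of characteristic zero; modules are right modules (equivalently, representations of the quiver with relations). Canonical algebra. Let $n\ge2$, $p_1,\dots,p_n\ge1$, and $\lambda_3,\dots,\lambda_n\in k$ nonzero and pairwise distinct. $A=kQ/I$ where $Q$ has a source vertex $0$, a sink vertex $\vec c$, and for each $i=1,\dots,n$ a linear arm of $p_i$ arrows $0\to\vec x_i\to2\vec x_i\to\cdots\to(p_i-1)\vec x_i\to\vec c$ (a single arrow $0\to\vec c$ if $p_i=1$). Write $x_i^{p_i}$ for the path along the $i$-th arm from $0$ to $\vec c$. The relations are $x_i^{p_i}=x_1^{p_1}+\lambda_ix_2^{p_2}$ for $i\ge3$. Let $\nu_1=(-\otimes^{\mathbf L}_ADA)[-1]$ with $D=\mathrm{Hom}_k(-,k)$. $M$ is Serre stable if $\nu_1M\simeq M$ in $D^b(\mathrm{mod}\,A)$; equivalently $\mathrm{Tor}^A_1(M,DA)\simeq M$ and $\mathrm{Tor}^A_i(M,DA)=0$ for $i\ne1$. The $k$-points of $\mathbb{X}^S$ are given by the Serre stable $A$-modules of dimension vector $\mathbf{1}$. The Euler form on $K_0(A)$ is $\langle[M],[N]\rangle=\sum_i(-1)^i\dim_k\mathrm{Ext}^i_A(M,N)$.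 A nonzero $A$-module $M$ is regular simple (with respect to $\vec d=\mathbf{1}$) if $\langle\vec d,[M]\rangle=0$ but $\langle\vec d,[N]\rangle<0$ for every nonzero proper submodule $N$ of $M$; a module is regular semisimple if it is a direct sum of regular simples. *)

(* Defs.v *)
From HB Require Import structures.
From mathcomp Require Import all_boot all_order all_algebra all_field.

Set Implicit Arguments.
Unset Strict Implicit.
Unset Printing Implicit Defensive.

Import GRing.Theory.
Local Open Scope ring_scope.

(* * Path algebras of finite acyclic quivers *)

Record quiver := Quiver {
  vertex : finType;
  arrow : finType;
  src : arrow -> vertex;
  tgt : arrow -> vertex;
  vertex_gt0 : (0 < #|vertex|)%N
}.

Section Paths.
Variable Q : quiver.

Fixpoint walk (v : vertex Q) (s : seq (arrow Q)) : bool :=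
  if s is a :: s' then (src a == v) && walk (tgt a) s' else true.

Definition walk_end (v : vertex Q) (s : seq (arrow Q)) : vertex Q :=
  last v (map (@tgt Q) s).

(* A path in an acyclic quiver never meets a vertex twice, so that it has     *)
(* fewer than #|vertex Q| arrows: the length bound, which makes qpath a       *)
(* finite type, excludes no path of an acyclic quiver.                        *)
Definition qpath : predArgType :=
  {x : vertex Q * (#|vertex Q|).-bseq (arrow Q) | walk x.1 x.2}.

Definition qstart (p : qpath) : vertex Q := (val p).1.
Definition qarrows (p : qpath) : seq (arrow Q) := (val p).2.
Definition qend (p : qpath) : vertex Q := walk_end (qstart p) (qarrows p).

(* Paths are composed from left to right.                                     *)
Definition is_concat (p q r : qpath) : bool :=
  [&& qstart r == qstart p, qend p == qstart q
    & qarrows r == qarrows p ++ qarrows q].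

End Paths.

(* The path algebra kQ: an element is its family of coefficients on paths.    *)
Definition path_algebra (k : fieldType) (Q : quiver) : Type :=
  {ffun qpath Q -> k^o}.

Section PathAlgebra.
Variables (k : fieldType) (Q : quiver).
Local Notation kQ := (path_algebra k Q).

HB.instance Definition _ :=
  Vector.copy (path_algebra k Q) {ffun qpath Q -> k^o}.

Definition pa_one : kQ := [ffun r => (qarrows r == [::])%:R].
Definition pa_mul (f g : kQ) : kQ :=
  [ffun r => \sum_p \sum_(q | is_concat p q r) f p * g q].

Lemma walk_cat (v : vertex Q) s1 s2 :
  walk v (s1 ++ s2) = walk v s1 && walk (walk_end v s1) s2.
Proof. by elim: s1 v => //= a s IHs v; rewrite IHs andbA. Qed.

Lemma walk_end_cat (v : vertex Q) s1 s2 :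
  walk_end v (s1 ++ s2) = walk_end (walk_end v s1) s2.
Proof. by rewrite /walk_end map_cat last_cat. Qed.

Lemma qpath_eq (p q : qpath Q) :
  qstart p = qstart q -> qarrows p = qarrows q -> p = q.
Proof.
rewrite /qstart /qarrows => e1 e2; apply/val_inj.
case: (val p) (val q) e1 e2 => [v s] [w t] /= -> e; congr pair; exact: val_inj.
Qed.

Lemma qpath_walk (p : qpath Q) : walk (qstart p) (qarrows p).
Proof. exact: (valP p). Qed.

Lemma qpath_size (p : qpath Q) : (size (qarrows p) <= #|vertex Q|)%N.
Proof. by rewrite /qarrows; case: (val p) => v [s /= ?]. Qed.

Lemma qpath_exists (v : vertex Q) (s : seq (arrow Q)) :
  walk v s -> (size s <= #|vertex Q|)%N ->
  exists2 p : qpath Q, qstart p = v & qarrows p = s.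
Proof.
move=> ws sz.
by exists (@exist (vertex Q * (#|vertex Q|).-bseq (arrow Q))
             (fun x => walk x.1 x.2) (v, Bseq sz) ws).
Qed.

Definition is_concat3 (p q t r : qpath Q) : bool :=
  [&& qstart r == qstart p, qend p == qstart q, qend q == qstart t
    & qarrows r == qarrows p ++ qarrows q ++ qarrows t].

Lemma sum_uniq (P : pred (qpath Q)) (b : bool) (c : k) :
  (forall s s', P s -> P s' -> s = s') -> ((exists s, P s) <-> b) ->
  \sum_s c *+ P s = c *+ b.
Proof.
move=> uP eP; case: b eP => [[_ /(_ isT) [s Ps]] | [nP _]].
  rewrite (bigD1 s) //= Ps big1 ?addr0 // => s' ne.
  by case: (boolP (P s')) => // /uP/(_ Ps) e; rewrite e eqxx in ne.
by rewrite big1 // => s _; case: (boolP (P s)) => // Ps; have := nP (ex_intro _ s Ps).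
Qed.

Lemma concat_left (p q t r : qpath Q) (c : k) :
  \sum_s c *+ (is_concat p q s && is_concat s t r) = c *+ is_concat3 p q t r.
Proof.
apply: sum_uniq => [s s' /andP[/and3P[/eqP a _ /eqP b] _]|].
  by move=> /andP[/and3P[/eqP a' _ /eqP b'] _]; apply: qpath_eq; congruence.
split=> [[s /andP[]]|].
  case/and3P=> /eqP a /eqP b /eqP c0 /and3P[/eqP a' /eqP b' /eqP c'].
  have es : qend s = qend q by rewrite /qend a c0 walk_end_cat -/(qend p) b.
  by rewrite /is_concat3 a' a b -es b' c' c0 catA !eqxx.
case/and4P=> /eqP h1 /eqP h2 /eqP h3 /eqP h4.
have := qpath_walk r; rewrite h1 h4 catA walk_cat => /andP[ws _].
have szs : (size (qarrows p ++ qarrows q) <= #|vertex Q|)%N.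
  by apply: leq_trans (qpath_size r); rewrite h4 catA [in leqRHS]size_cat leq_addr.
have [s s1 s2] := qpath_exists ws szs; exists s.
have es : qend s = qend q by rewrite {1}/qend s1 s2 walk_end_cat -/(qend p) h2.
by rewrite /is_concat es s1 s2 h1 h2 h3 h4 catA !eqxx.
Qed.

Lemma concat_right (p q t r : qpath Q) (c : k) :
  \sum_s c *+ (is_concat q t s && is_concat p s r) = c *+ is_concat3 p q t r.
Proof.
apply: sum_uniq => [s s' /andP[/and3P[/eqP a _ /eqP b] _]|].
  by move=> /andP[/and3P[/eqP a' _ /eqP b'] _]; apply: qpath_eq; congruence.
split=> [[s /andP[]]|].
  case/and3P=> /eqP a /eqP b /eqP c0 /and3P[/eqP a' /eqP b' /eqP c'].
  by rewrite /is_concat3 a' b' a b c' c0 !eqxx.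
case/and4P=> /eqP h1 /eqP h2 /eqP h3 /eqP h4.
have := qpath_walk r; rewrite h1 h4 walk_cat -/(qend p) h2 => /andP[_ ws].
have szs : (size (qarrows q ++ qarrows t) <= #|vertex Q|)%N.
  by apply: leq_trans (qpath_size r); rewrite h4 [in leqRHS]size_cat leq_addl.
have [s s1 s2] := qpath_exists ws szs; exists s.
by rewrite /is_concat s1 s2 h1 h2 h3 h4 !eqxx.
Qed.

Lemma pa_mulE (f g : kQ) r :
  pa_mul f g r = \sum_p \sum_q (f p * g q) *+ is_concat p q r.
Proof.
rewrite ffunE; apply: eq_bigr => p _; rewrite big_mkcond /=.
by apply: eq_bigr => q _; rewrite mulrb.
Qed.

Lemma pa_mulA : associative pa_mul.
Proof.
move=> f g h; apply/ffunP=> r; rewrite !pa_mulE.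
transitivity (\sum_p \sum_q \sum_t
   (f p * g q * h t) *+ is_concat3 p q t r).
  apply: eq_bigr => p _.
  transitivity (\sum_s \sum_q \sum_t
    (f p * g q * h t) *+ (is_concat q t s && is_concat p s r)).
    apply: eq_bigr => s _; rewrite pa_mulE mulr_sumr -sumrMnl.
    apply: eq_bigr => q _; rewrite mulr_sumr -sumrMnl.
    by apply: eq_bigr => t _; rewrite mulrnAr -mulrnA mulrA mulnb.
  rewrite exchange_big; apply: eq_bigr => q _.
  rewrite exchange_big; apply: eq_bigr => t _; exact: concat_right.
symmetry.
transitivity (\sum_s \sum_p \sum_q \sum_t
    (f p * g q * h t) *+ (is_concat p q s && is_concat s t r)).
  apply: eq_bigr => s _.
  under eq_bigr do rewrite pa_mulE mulr_suml -sumrMnl.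
  rewrite exchange_big; apply: eq_bigr => p _.
  under eq_bigr do rewrite mulr_suml -sumrMnl.
  rewrite exchange_big; apply: eq_bigr => q _.
  by apply: eq_bigr => t _; rewrite mulrnAl -mulrnA mulnb.
rewrite exchange_big; apply: eq_bigr => p _.
rewrite exchange_big; apply: eq_bigr => q _.
rewrite exchange_big; apply: eq_bigr => t _; exact: concat_left.
Qed.

Lemma pa_mul1 : left_id pa_one pa_mul.
Proof.
move=> f; apply/ffunP=> r; rewrite pa_mulE.
have [e e1 e2] := @qpath_exists (qstart r) [::] isT (leq0n _).
rewrite (bigD1 e) //= [X in _ + X]big1 ?addr0 => [|p ne]; last first.
  rewrite big1 // => q _; rewrite ffunE.
  case: eqP => [p0|]; last by rewrite mul0r mul0rn.
  case: (boolP (is_concat p q r)) => // /and3P[/eqP ep _ _].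
  by case/eqP: ne; apply: qpath_eq; rewrite ?e2 // e1.
rewrite (bigD1 r) //= [X in _ + X]big1 ?addr0 => [|q ne]; last first.
  case: (boolP (is_concat e q r)) => // /and3P[_ /eqP eq1].
  rewrite e2 => /eqP eq2; case/eqP: ne; apply: qpath_eq => //.
  by rewrite -eq1 /qend e1 e2.
by rewrite /is_concat /qend ffunE e1 e2 !eqxx mul1r.
Qed.

Lemma pa_mulr1 : right_id pa_one pa_mul.
Proof.
move=> f; apply/ffunP=> r; rewrite pa_mulE.
have [e e1 e2] := @qpath_exists (qend r) [::] isT (leq0n _).
rewrite (bigD1 r) //= [X in _ + X]big1 ?addr0 => [|p ne]; last first.
  rewrite big1 // => q _; rewrite ffunE.
  case: eqP => [q0|]; last by rewrite mulr0 mul0rn.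
  case: (boolP (is_concat p q r)) => // /and3P[/eqP ep _ /eqP].
  by rewrite q0 cats0 => er; case/eqP: ne; apply: qpath_eq.
rewrite (bigD1 e) //= [X in _ + X]big1 ?addr0 => [|q ne]; last first.
  rewrite ffunE; case: eqP => [q0|]; last by rewrite mulr0 mul0rn.
  case: (boolP (is_concat r q r)) => // /and3P[_ /eqP eq1 _].
  by case/eqP: ne; apply: qpath_eq; rewrite ?e2 // e1.
by rewrite /is_concat ffunE e1 e2 cats0 !eqxx mulr1.
Qed.

Lemma pa_mulDl : left_distributive pa_mul +%R.
Proof.
move=> f g h; apply/ffunP=> r; rewrite [RHS]ffunE !pa_mulE -big_split.
apply: eq_bigr => p _; rewrite -big_split; apply: eq_bigr => q _.
by rewrite ffunE mulrDl mulrnDl.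
Qed.

Lemma pa_mulDr : right_distributive pa_mul +%R.
Proof.
move=> f g h; apply/ffunP=> r; rewrite [RHS]ffunE !pa_mulE -big_split.
apply: eq_bigr => p _; rewrite -big_split; apply: eq_bigr => q _.
by rewrite ffunE mulrDr mulrnDl.
Qed.

Lemma pa_oner_neq0 : pa_one != 0.
Proof.
have /card_gt0P[v _] := vertex_gt0 Q.
have [e _ e2] := @qpath_exists v [::] isT (leq0n _).
apply/eqP=> /ffunP/(_ e); rewrite !ffunE e2 eqxx => /eqP.
by rewrite oner_eq0.
Qed.

HB.instance Definition _ := GRing.Zmodule_isNzRing.Build (path_algebra k Q)
  pa_mulA pa_mul1 pa_mulr1 pa_mulDl pa_mulDr pa_oner_neq0.

Lemma pa_scaleAl (c : k) (f g : kQ) : c *: pa_mul f g = pa_mul (c *: f) g.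
Proof.
apply/ffunP=> r; rewrite [LHS]ffunE !pa_mulE scaler_sumr.
apply: eq_bigr => p _; rewrite scaler_sumr; apply: eq_bigr => q _.
by rewrite ffunE -scalerMnr scalerAl.
Qed.

HB.instance Definition _ :=
  GRing.Lmodule_isLalgebra.Build k (path_algebra k Q) pa_scaleAl.

Lemma pa_scaleAr (c : k) (f g : kQ) : c *: pa_mul f g = pa_mul f (c *: g).
Proof.
apply/ffunP=> r; rewrite [LHS]ffunE !pa_mulE scaler_sumr.
apply: eq_bigr => p _; rewrite scaler_sumr; apply: eq_bigr => q _.
by rewrite ffunE -scalerMnr scalerAr.
Qed.

HB.instance Definition _ :=
  GRing.Lalgebra_isAlgebra.Build k (path_algebra k Q) pa_scaleAr.
HB.instance Definition _ := Algebra_isFalgebra.Build k (path_algebra k Q).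

(* The path with start v and successive arrows s, if there is such a path,    *)
(* and 0 otherwise; path_elt v [::] is the idempotent at the vertex v.        *)
Definition path_elt (v : vertex Q) (s : seq (arrow Q)) : kQ :=
  [ffun p => ((qstart p == v) && (qarrows p == s))%:R].

End PathAlgebra.

(* * Right modules over a finite-dimensional algebra *)

(* Finite-dimensional right modules: ract M a x is x.a.                       *)
Record rmodule (k : fieldType) (A : falgType k) := RModule {
  rsort :> vectType k;
  ract : {linear A -> 'End(rsort)};
  ract1 : ract 1 = \1%VF;
  ractM : forall a b, ract (a * b) = (ract b \o ract a)%VF
}.

Section Modules.
Variables (k : fieldType) (A : falgType k).
Implicit Types M N : rmodule A.

Definition is_hom M N (f : 'Hom(M, N)) : Prop :=
  forall x a, f (ract M a x) = ract N a (f x).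

(* Hom_A(M, N) as a subspace of Hom_k(M, N): A-linearity is tested on a basis *)
(* of A.                                                                      *)
Definition hom_space M N : {vspace 'Hom(M, N)} :=
  (\bigcap_(i < \dim {:A})
     lker (linfun (fun f : 'Hom(M, N) =>
       (f \o ract M (vbasis {:A})`_i)%VF - (ract N (vbasis {:A})`_i \o f)%VF)))%VS.

Lemma mem_hom_space M N (f : 'Hom(M, N)) : f \in hom_space M N <-> is_hom f.
Proof.
pose D a (g : 'Hom(M, N)) := (g \o ract M a)%VF - (ract N a \o g)%VF.
have lD a : linear (D a).
  move=> c g h; rewrite /D comp_lfunDl -comp_lfunZl comp_lfunDr -comp_lfunZr.
  by rewrite opprD addrACA scalerBr.
have eD a g : linfun (D a) g = D a g.
  pose L := GRing.isLinear.Build k _ _ _ (D a) (lD a).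
  pose Dl : {linear 'Hom(M, N) -> 'Hom(M, N)} := HB.pack (D a) L.
  exact: (lfunE Dl g).
have D0 a : D a f = 0 <-> forall x, f (ract M a x) = ract N a (f x).
  split=> [/eqP|h]; last first.
    by apply/lfunP=> x; rewrite !lfunE /= opp_lfunE !comp_lfunE h subrr.
  rewrite subr_eq0 => /eqP e x; have /lfunP/(_ x) := e.
  by rewrite !comp_lfunE.
split=> [|hf]; last first.
  rewrite memvE; apply/subv_bigcapP=> i _; rewrite -memvE memv_ker.
  by apply/eqP; rewrite eD; apply/D0=> x; apply: hf.
rewrite memvE => /subv_bigcapP fD x a.
rewrite (coord_vbasis (memvf a)) !linear_sum !sum_lfunE linear_sum.
apply: eq_bigr => i _; rewrite !linearZ !scale_lfunE linearZ /=; congr (_ *: _).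
move: (fD i isT); rewrite -memvE memv_ker eD => /eqP/D0; exact.
Qed.

Definition projective (P : rmodule A) : Prop :=
  forall (M N : rmodule A) (g : 'Hom(M, N)) (f : 'Hom(P, N)),
    is_hom g -> limg g = fullv -> is_hom f ->
  exists2 h : 'Hom(P, M), is_hom h & (g \o h)%VF = f.

Record proj_resolution M := ProjResolution {
  pr_obj : nat -> rmodule A;
  pr_diff : forall i, 'Hom(pr_obj i.+1, pr_obj i);
  pr_aug : 'Hom(pr_obj 0, M);
  pr_projective : forall i, projective (pr_obj i);
  pr_diff_hom : forall i, is_hom (pr_diff i);
  pr_aug_hom : is_hom pr_aug;
  pr_aug_onto : limg pr_aug = fullv;
  pr_exact0 : limg (pr_diff 0) = lker pr_aug;
  pr_exactS : forall i, limg (pr_diff i.+1) = lker (pr_diff i)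
}.

(* ** Ext and the Euler form *)

Section Ext.
Variables (M N : rmodule A) (P : proj_resolution M).

Definition ext_diff (i : nat) :
    'Hom('Hom(pr_obj P i, N), 'Hom(pr_obj P i.+1, N)) :=
  linfun (fun f => (f \o pr_diff P i)%VF).

Definition ext_cocycles (i : nat) : {vspace 'Hom(pr_obj P i, N)} :=
  (hom_space (pr_obj P i) N :&: lker (ext_diff i))%VS.

Definition ext_coboundaries (i : nat) : {vspace 'Hom(pr_obj P i, N)} :=
  if i is j.+1 then (ext_diff j @: hom_space (pr_obj P j) N)%VS else 0%VS.

Definition ext_dim (i : nat) : nat :=
  (\dim (ext_cocycles i) - \dim (ext_coboundaries i))%N.

End Ext.

(* euler_form M N z: the alternating sum of the dimensions of the Ext^i(M, N) *)
(* is z. These dimensions do not depend on the projective resolution.         *)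
Definition euler_form M N (z : int) : Prop :=
  exists (P : proj_resolution M) (l : nat),
    (forall i, (l <= i)%N -> ext_dim N P i = 0%N) /\
    z = \sum_(i < l) (-1) ^+ i * (ext_dim N P i)%:Z.

(* ** Tensor products with the bimodule DA *)

Local Notation DA := 'Hom(A, k^o).

(* The left action on DA = Hom_k(A, k): (a phi)(b) = phi(ba).                 *)
Definition dual_lact (a : A) (phi : DA) : DA := linfun (fun b => phi (b * a)).

(* As A is finite-dimensional, M (x)_k DA is Hom_k(A, M), with x (x) phi the  *)
(* map b |-> phi(b) x; this is the pure tensor x (x) phi. The right action of *)
(* A, induced by (phi a)(b) = phi(ab), is then (t a)(b) = t(ab).              *)
Definition tens M (x : M) (phi : DA) : 'Hom(A, M) := linfun (fun b => phi b *: x).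

Definition tens_ract M (a : A) (t : 'Hom(A, M)) : 'Hom(A, M) :=
  linfun (fun b => t (a * b)).

(* M (x)_A DA is the quotient of M (x)_k DA by the span of the balancing      *)
(* relations xa (x) phi - x (x) a phi.                                        *)
Definition balancing M : {vspace 'Hom(A, M)} :=
  <<[seq tens (ract M a u.1) u.2 - tens u.1 (dual_lact a u.2)
      | u <- [seq (x, phi) | x <- vbasis {:M}, phi <- vbasis {:DA}],
        a <- vbasis {:A}]>>%VS.

(* ** Tor with values in DA *)

Section Tor.
Variables (M : rmodule A) (P : proj_resolution M).

(* The map pr_diff (x) DA, on Hom_k(A, -).                                    *)
Definition tor_diff (i : nat) :
    'Hom('Hom(A, pr_obj P i.+1), 'Hom(A, pr_obj P i)) :=
  linfun (fun t => (pr_diff P i \o t)%VF).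

(* The cycles and boundaries of P (x)_A DA, as subspaces of P_i (x)_k DA that *)
(* contain the balancing relations.                                           *)
Definition tor_cycles (i : nat) : {vspace 'Hom(A, pr_obj P i)} :=
  if i is j.+1 then (tor_diff j @^-1: balancing (pr_obj P j))%VS else fullv.

Definition tor_boundaries (i : nat) : {vspace 'Hom(A, pr_obj P i)} :=
  (limg (tor_diff i) + balancing (pr_obj P i))%VS.

Definition tor_eq0 (i : nat) : Prop := (tor_cycles i <= tor_boundaries i)%VS.

(* The right module cycles / boundaries is isomorphic to T.                   *)
Definition tor_iso (i : nat) (T : rmodule A) : Prop :=
  exists phi : 'Hom('Hom(A, pr_obj P i), T),
    [/\ (phi @: tor_cycles i)%VS = fullv,
        (tor_cycles i :&: lker phi)%VS = tor_boundaries i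
      & forall t a, t \in tor_cycles i ->
          phi (tens_ract a t) = ract T a (phi t)].

End Tor.

(* M is isomorphic to (M (x)^L_A DA)[-1]; the homology of P (x)_A DA does not *)
(* depend on the projective resolution P of M.                                *)
Definition serre_stable M : Prop :=
  exists P : proj_resolution M,
    tor_iso P 1 M /\ forall i, i != 1%N -> tor_eq0 P i.

(* ** Submodules *)

Record submodule M := Submodule {
  sub_space :> {vspace M};
  sub_stable : forall a x, x \in sub_space -> ract M a x \in sub_space
}.

Section SubmoduleModule.
Variables (M : rmodule A) (U : submodule M).

Definition sub_ract (a : A) : 'End(subvs_of U) :=
  linfun (fun u => vsproj U (ract M a (vsval u))).

Lemma sub_ractE a u : vsval (sub_ract a u) = ract M a (vsval u).
Proof.
pose L : {linear subvs_of U -> subvs_of U} := vsproj U \o (ract M a \o vsval).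
rewrite -[sub_ract a]/(linfun L) lfunE /= vsprojK //.
by apply: sub_stable; apply: subvsP.
Qed.

Lemma sub_ract_linear : linear sub_ract.
Proof.
move=> c a b; apply/lfunP=> u; apply: val_inj => /=.
by rewrite sub_ractE linearP !(add_lfunE, scale_lfunE) linearP /= !sub_ractE.
Qed.

HB.instance Definition _ :=
  GRing.isLinear.Build k A 'End(subvs_of U) *:%R sub_ract sub_ract_linear.

Lemma sub_ract1 : sub_ract 1 = \1%VF.
Proof.
by apply/lfunP=> u; apply: val_inj; rewrite /= sub_ractE ract1 !id_lfunE.
Qed.

Lemma sub_ractM a b : sub_ract (a * b) = (sub_ract b \o sub_ract a)%VF.
Proof.
apply/lfunP=> u; apply: val_inj.
by rewrite /= comp_lfunE !sub_ractE ractM comp_lfunE.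
Qed.

Definition submod : rmodule A := RModule sub_ract1 sub_ractM.

End SubmoduleModule.

(* ** Regular simple and regular semisimple modules *)

Section Regular.
(* The vertices of a quiver, and the corresponding idempotents of A.          *)
Variables (I : finType) (e : I -> A).

Definition dim_vector M : {ffun I -> nat} :=
  [ffun v => \dim (limg (ract M (e v)))].

(* The form <d, [N]>: the element of K_0(A) with dimension vector d is the    *)
(* class [X] of any module X of dimension vector d.                           *)
Definition euler_form_dim (d : {ffun I -> nat}) N (z : int) : Prop :=
  exists2 X : rmodule A, dim_vector X = d & euler_form X N z.

Definition regular_simple (d : {ffun I -> nat}) M : Prop :=
  [/\ {:M}%VS != 0%VS,
      euler_form_dim d M 0
    & forall U : submodule M, U != 0%VS :> {vspace M} -> U != {:M}%VS :> {vspace M} ->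
      exists2 z : int, euler_form_dim d (submod U) z & z < 0].

Definition regular_semisimple (d : {ffun I -> nat}) M : Prop :=
  exists (r : nat) (U : 'I_r -> submodule M),
    [/\ directv (\sum_i U i)%VS,
        (\sum_i U i)%VS = {:M}%VS
      & forall i, regular_simple d (submod (U i))].

End Regular.

End Modules.

(* * Canonical algebras *)

Section Canonical.
(* There are n = m + 2 arms, and lam i is the parameter of the arm i + 2 when *)
(* arms are counted from 0, that is, lambda_(i+3) when they are counted from 1. *)
Variables (k : fieldType) (m : nat) (p : 'I_m.+2 -> nat) (lam : 'I_m -> k).

(* inl false is the source 0, inl true is the sink c and inr (Tagged _ j) is  *)
(* (j + 1) x_i, for j < p i - 1.                                              *)
Definition can_vertex : finType := (bool + {i : 'I_m.+2 & 'I_(p i).-1})%type.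

Definition can_source : can_vertex := inl false.
Definition can_sink : can_vertex := inl true.

(* The vertex j x_i, with 0 x_i = 0 and (p i) x_i = c.                        *)
Definition arm_vertex (i : 'I_m.+2) (j : nat) : can_vertex :=
  if j is j'.+1 then
    if insub j' is Some l
    then inr (Tagged (fun i => 'I_(p i).-1) (l : 'I_(p i).-1))
    else can_sink
  else can_source.

Definition can_arrow : finType := {i : 'I_m.+2 & 'I_(p i)}.

Lemma can_vertex_gt0 : (0 < #|can_vertex|)%N.
Proof. by apply/card_gt0P; exists can_source. Qed.

Definition canonical_quiver : quiver :=
  @Quiver can_vertex can_arrow
    (fun a => arm_vertex (tag a) (tagged a))
    (fun a => arm_vertex (tag a) (tagged a).+1) can_vertex_gt0.

(* The path x_i^(p i).                                                        *)
Definition arm_path (i : 'I_m.+2) : path_algebra k canonical_quiver :=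
  path_elt k (can_source : vertex canonical_quiver)
    [seq (Tagged (fun i => 'I_(p i)) j : arrow canonical_quiver)
      | j <- enum 'I_(p i)].

Definition canonical_relation (i : 'I_m) : path_algebra k canonical_quiver :=
  arm_path (rshift 2 i) - (arm_path ord0 + lam i *: arm_path (lift ord0 ord0)).

Definition canonical_ideal : {vspace path_algebra k canonical_quiver} :=
  ({: path_algebra k canonical_quiver} * <<codom canonical_relation>>
    * {: path_algebra k canonical_quiver})%VS.

(* pi is a quotient map from kQ to A = kQ / I.                                *)
Definition is_canonical_algebra (A : falgType k)
    (pi : {lrmorphism path_algebra k canonical_quiver -> A}) : Prop :=
  (forall y, exists x, pi x = y) /\ (forall x, pi x = 0 <-> x \in canonical_ideal).

Definition vertex_idem (A : falgType k)
    (pi : {lrmorphism path_algebra k canonical_quiver -> A}) (v : can_vertex) : A :=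
  pi (path_elt k (v : vertex canonical_quiver) [::]).

Definition ones : {ffun can_vertex -> nat} := [ffun=> 1%N].

End Canonical.

(* Main.v *)
From HB Require Import structures.
Require Import Defs.
From mathcomp Require Import all_boot all_order all_algebra all_field.
From mathcomp Require Import ring.

Set Implicit Arguments.
Unset Strict Implicit.
Unset Printing Implicit Defensive.

Import GRing.Theory.
Local Open Scope ring_scope.

(** For the class d all of whose entries are 1, the Euler form is explicit:
    <d, [N]> = dim N_0 - dim N_c, where 0 is the source and c the sink. Indeed,
    let u be the path along the first arm. Left multiplication by u is an
    injective map e_c A -> e_0 A, whose cokernel X has dimension vector d because
    e_0 A e_c has the basis given by the paths along the first two arms; and
    0 -> e_c A -> e_0 A -> X -> 0 computes Ext (euler_form_cokmod,
    euler_module_dim). Hence a simple module at an inner vertex of an arm is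
    regular simple, and so is a module with one-dimensional components at 0 and
    c which is generated by its component at 0 and all of whose nonzero
    submodules contain its component at c.

    A module M of dimension vector d has one scalar for each arrow. It is enough
    to know that the scalars of an arm are all zero or all nonzero, and that some
    arm is of the second kind. For M is then the direct sum of the simple modules
    at the inner vertices of the zero arms and of a module supported on all
    other vertices, and these are regular simple (label, piece_simple).

    Serre stability yields this through serre_stable_coker. The space
    Tor_i(M, DA) is dual to Ext^i(M, A), so that Tor_0(M, DA) = 0 means
    Hom(M, A) = 0, while Tor_1(M, DA) = M means that Ext^1(M, A) is the left
    module DM. Let N be the cokernel of an injective map b : e'A -> eA. By the
    long exact sequence Hom(M, N) is the kernel of Ext^1(M, e'A) -> Ext^1(M, eA),
    which is dual to the map Me -> Me' given by b. So a nonzero map M -> N implies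
    that Mb is not all of Me'. There are three applications.
    - If all arrows into c acted by zero, then M would map onto e_c A; with
      e' = b = 0 this is a contradiction (nonzero_arm_end).
    - If the arrow into an inner vertex acts by zero, then M maps onto the simple
      module at this vertex, so that the arrow out of it acts by zero
      (zero_arrow_next).
    - If the last arrow of the arm i acts by zero and the other arms are nonzero,
      then M maps onto the cokernel of the first arrow of the arm i, so that this
      arrow acts by zero (zero_arrow_first).
    By the second point zeros propagate along an arm up to its last arrow, by the
    third one from there to its first arrow, hence to all arrows. The hypothesis
    of the third point holds because two zero arms would make all arms zero: the
    path along any arm is a linear combination of the paths along any two
    others, since the lambda_i are nonzero and distinct (arm_span). *)

Local Notation "x |> a" := (ract _ a x) (at level 40, left associativity).

(** * Linear algebra *)

Section LinearAlgebra.
Variable k : fieldType.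
Implicit Types U V W : vectType k.

Lemma linfunE U V (f : U -> V) : linear f -> linfun f =1 f.
Proof.
move=> lf; pose L := GRing.isLinear.Build k _ _ _ f lf.
pose fl : {linear U -> V} := HB.pack f L.
exact: (lfunE fl).
Qed.

Lemma lfun0 U V (f : 'Hom(U, V)) : f 0 = 0. Proof. exact: linear0. Qed.

Lemma lfunB U V (f : 'Hom(U, V)) u v : f (u - v) = f u - f v.
Proof. exact: linearB. Qed.

Lemma lfunZ U V (f : 'Hom(U, V)) c u : f (c *: u) = c *: f u.
Proof. exact: linearZ. Qed.

Lemma lfunDZ U V (f : 'Hom(U, V)) c u v : f (c *: u + v) = c *: f u + f v.
Proof. exact: linearP. Qed.

Lemma vbasis_ind V (P : V -> Prop) : P 0 ->
    (forall c u v, P u -> P v -> P (c *: u + v)) ->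
    (forall u, u \in vbasis {:V} -> P u) -> forall u, P u.
Proof.
move=> P0 PD Pb u; rewrite (coord_vbasis (memvf u)).
elim/big_rec: _ => // i y _; apply: PD; apply: Pb.
by apply: mem_nth; rewrite size_tuple.
Qed.

(** The map psi kills the preimage of B under L, hence descends to the image of
    L modulo B, which is everything. *)
Lemma factor_modulo V W (X : vectType k) (L : 'Hom(V, W)) (B : {vspace W})
    (psi : 'Hom(V, X)) :
    (fullv <= limg L + B)%VS -> (forall v, L v \in B -> psi v = 0) ->
  exists psi' : 'Hom(W, X),
    (forall v, psi' (L v) = psi v) /\ (forall b, b \in B -> psi' b = 0).
Proof.
move=> LB psi0; pose q := addv_pi1 (limg L) B.
have qB w : w - q w \in B.
  have /addv_pi1_pi2 {1}<- := subvP LB w (memvf w).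
  by rewrite addrC addKr memv_pi2.
have Lq w : L (L^-1%VF (q w)) = q w by rewrite limg_lfunVK ?memv_pi1.
exists (psi \o L^-1 \o q)%VF; split=> [v|b bB]; rewrite !comp_lfunE.
  apply: subr0_eq; rewrite -linearB; apply: psi0.
  by rewrite linearB /= Lq -opprB memvN qB.
apply: psi0; rewrite Lq -(subKr b (q b)).
by rewrite memvB ?qB.
Qed.

End LinearAlgebra.

(** * Right ideals and quotient modules *)

Section ModuleTheory.
Variables (k : fieldType) (A : falgType k).
Implicit Types (M N P : rmodule A) (a b e : A).

Lemma ractMr M (x : M) a b : x |> (a * b) = x |> a |> b.
Proof. by rewrite ractM comp_lfunE. Qed.

Lemma ract1r M (x : M) : x |> 1 = x.
Proof. by rewrite ract1 id_lfunE. Qed.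

Lemma ractDr M (x : M) a b : x |> (a + b) = x |> a + x |> b.
Proof. by rewrite linearD add_lfunE. Qed.

Lemma ractZr M (x : M) c a : x |> (c *: a) = c *: (x |> a).
Proof. by rewrite linearZ scale_lfunE. Qed.

Lemma ract0r M (x : M) : x |> 0 = 0.
Proof. by rewrite linear0 zero_lfunE. Qed.

Lemma ract_sumr M (x : M) (I : Type) (r : seq I) (Q : pred I) (F : I -> A) :
  x |> (\sum_(i <- r | Q i) F i) = \sum_(i <- r | Q i) x |> F i.
Proof. by rewrite linear_sum sum_lfunE. Qed.

Lemma regmod_act1 : amulr (1 : A) = \1%VF.
Proof. by apply/lfunP=> x; rewrite !lfunE /= mulr1. Qed.

Lemma regmod_actM a b : amulr (a * b) = (amulr b \o amulr a)%VF.
Proof. by apply/lfunP=> x; rewrite !lfunE /= !lfunE /= mulrA. Qed.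

Definition regmod : rmodule A :=
  @RModule k A A (@amulr k A) regmod_act1 regmod_actM.

Lemma regmodE (x : regmod) a : x |> a = (x : A) * a.
Proof. by rewrite /= lfunE. Qed.

Lemma amullE a x : amull a x = a * x.
Proof. by rewrite lfunE. Qed.

Lemma limg_amullP e (x : A) : reflect (exists y, x = e * y) (x \in limg (amull e)).
Proof.
apply: (iffP memv_imgP) => [[y _ ->]|[y ->]].
  by exists y; rewrite lfunE.
by exists y; rewrite ?memvf // lfunE.
Qed.

Lemma right_ideal_stable e a (x : regmod) :
  x \in limg (amull e) -> x |> a \in limg (amull e).
Proof.
case/limg_amullP=> y ->; rewrite regmodE; apply/limg_amullP.
by exists (y * a); rewrite mulrA.
Qed.

Definition right_ideal e : submodule regmod := Submodule (@right_ideal_stable e).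

Definition eproj e : rmodule A := submod (right_ideal e).

Lemma vsval_act M (U : submodule M) (u : submod U) a :
  vsval (u |> a) = vsval u |> a.
Proof. exact: sub_ractE. Qed.

(** A map out of eA is determined by the image of e, which can be any y with ye = y. *)
Lemma eproj_projective e : e * e = e -> projective (eproj e).
Proof.
move=> ee M N g f hg gN hf.
have e_in : e \in right_ideal e by apply/limg_amullP; exists e; rewrite ee.
have /memv_imgP[y _ fy] : f (vsproj _ e) \in limg g by rewrite gN memvf.
have hE (u : eproj e) :
    linfun (fun u : eproj e => y |> (vsval u : A)) u = y |> (vsval u : A).
  by apply: linfunE => c a b; rewrite linearP add_lfunE scale_lfunE.
exists (linfun (fun u : eproj e => y |> (vsval u : A))).
  by move=> u a; rewrite !hE vsval_act regmodE ractMr.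
apply/lfunP=> u; rewrite comp_lfunE hE hg -fy -hf; congr (f _).
apply: subvs_inj; rewrite vsval_act vsprojK // regmodE.
by case/limg_amullP: (subvsP u) => z ->; rewrite mulrA ee.
Qed.

Section Quotient.
Variables (M : rmodule A) (U : submodule M).

(** The quotient of M by U is carried by a complement of U. *)
Definition quo_map : 'Hom(M, subvs_of U^C) :=
  (linfun (vsproj U^C) \o (\1 - projv U))%VF.

Lemma quo_mapE x : quo_map x = vsproj U^C (x - projv U x).
Proof.
by rewrite comp_lfunE lfunE /= add_lfunE opp_lfunE id_lfunE.
Qed.

Lemma quo_mapK (u : subvs_of U^C) : quo_map (vsval u) = u.
Proof.
rewrite quo_mapE -[RHS]vsvalK; congr (vsproj _ _).
suff /eqP->: projv U (vsval u) == 0 by rewrite subr0.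
by rewrite -memv_ker lker_proj subvsP.
Qed.

Lemma quo_map_eq0 x : (quo_map x == 0) = (x \in U).
Proof.
rewrite quo_mapE -subr_eq0 subr0; apply/eqP/idP => [e|xU].
  have := congr1 vsval e; rewrite vsprojK ?memv_projC // linear0 => /eqP.
  by rewrite subr_eq0 => /eqP->; apply: memv_proj.
by rewrite projv_id // subrr linear0.
Qed.

Lemma quo_map_eq x y : (quo_map x == quo_map y) = (x - y \in U).
Proof. by rewrite -subr_eq0 -linearB quo_map_eq0. Qed.

Definition quo_act a : 'End(subvs_of U^C) :=
  linfun (fun u => quo_map (vsval u |> a)).

Lemma quo_actE a u : quo_act a u = quo_map (vsval u |> a).
Proof. by apply: linfunE => c y z; rewrite !linearP. Qed.

Lemma quo_act_map a x : quo_act a (quo_map x) = quo_map (x |> a).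
Proof.
rewrite quo_actE; apply/eqP; rewrite quo_map_eq -linearB.
by apply: sub_stable; rewrite -quo_map_eq quo_mapK.
Qed.

Lemma quo_act_linear : linear quo_act.
Proof.
move=> c a b; apply/lfunP=> u.
by rewrite add_lfunE scale_lfunE !quo_actE ractDr ractZr linearP.
Qed.

HB.instance Definition _ :=
  GRing.isLinear.Build k A 'End(subvs_of U^C) *:%R quo_act quo_act_linear.

Lemma quo_act1 : quo_act 1 = \1%VF.
Proof. by apply/lfunP=> u; rewrite quo_actE ract1r quo_mapK id_lfunE. Qed.

Lemma quo_actM a b : quo_act (a * b) = (quo_act b \o quo_act a)%VF.
Proof.
by apply/lfunP=> u; rewrite comp_lfunE -[u]quo_mapK !quo_act_map ractMr.
Qed.

Definition quomod : rmodule A := RModule quo_act1 quo_actM.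

Lemma quo_map_hom : @is_hom k A M quomod quo_map.
Proof. by move=> x a; rewrite [RHS]quo_act_map. Qed.

End Quotient.

End ModuleTheory.

(** * The trace pairing *)

Section TraceDuality.
Variables (k : fieldType) (A : falgType k).
Local Notation DA := 'Hom(A, k^o).
Implicit Types (M N P : rmodule A) (a b e : A) (phi : DA) (V W : vectType k).

Lemma tensE M (x : M) phi b : tens x phi b = phi b *: x.
Proof. by apply: linfunE => c u v; rewrite lfunDZ scalerDl scalerA. Qed.

Lemma tensDl M c (x y : M) phi : tens (c *: x + y) phi = c *: tens x phi + tens y phi.
Proof.
apply/lfunP=> b; rewrite add_lfunE scale_lfunE !tensE scalerDr !scalerA.
by rewrite mulrC.
Qed.

Lemma tensDr M c (x : M) phi psi : tens x (c *: phi + psi) = c *: tens x phi + tens x psi.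
Proof.
apply/lfunP=> b; rewrite add_lfunE scale_lfunE !tensE.
by rewrite add_lfunE scale_lfunE scalerDl scalerA.
Qed.

Lemma dual_lactE a phi b : dual_lact a phi b = phi (b * a).
Proof. by apply: linfunE => c u v; rewrite mulrDl -scalerAl lfunDZ. Qed.

Lemma tens_ractE M a (t : 'Hom(A, M)) b : tens_ract a t b = t (a * b).
Proof. by apply: linfunE => c u v; rewrite mulrDr -scalerAr lfunDZ. Qed.

Lemma dual_lactDl c a b phi :
  dual_lact (c *: a + b) phi = c *: dual_lact a phi + dual_lact b phi.
Proof.
apply/lfunP=> u; rewrite add_lfunE scale_lfunE !dual_lactE.
by rewrite mulrDr -scalerAr lfunDZ.
Qed.

Lemma dual_lactDr c a phi psi :
  dual_lact a (c *: phi + psi) = c *: dual_lact a phi + dual_lact a psi.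
Proof.
by apply/lfunP=> u; rewrite add_lfunE scale_lfunE !dual_lactE add_lfunE scale_lfunE.
Qed.

Definition coordf (i : 'I_(\dim {:A})) : DA :=
  linfun (coord (vbasis {:A}) i : A -> k^o).

Lemma coordfE i a : coordf i a = coord (vbasis {:A}) i a.
Proof. by apply: linfunE => c u v; rewrite linearP. Qed.

Lemma dual_sep a b : (forall phi, phi a = phi b) -> a = b.
Proof.
move=> h; rewrite (coord_vbasis (memvf a)) (coord_vbasis (memvf b)).
apply: eq_bigr => i _; congr (_ *: _).
by have := h (coordf i); rewrite !coordfE.
Qed.

Lemma tens0l M phi : tens (0 : M) phi = 0.
Proof. by apply/lfunP=> b; rewrite tensE scaler0 zero_lfunE. Qed.

Lemma tens0r M (x : M) : tens x (0 : DA) = 0.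
Proof. by apply/lfunP=> b; rewrite tensE !zero_lfunE scale0r. Qed.

Definition tens_rel M (x : M) phi a : 'Hom(A, M) :=
  tens (x |> a) phi - tens x (dual_lact a phi).

(** The relations that span the balancing space involve basis elements only, but
    tens_rel is linear in each argument. *)
Lemma tens_rel_mem M (x : M) phi a : tens_rel x phi a \in balancing M.
Proof.
elim/vbasis_ind: x phi a => [phi a|c x y IHx IHy phi a|x xB].
- by rewrite /tens_rel lfun0 !tens0l subrr mem0v.
- rewrite /tens_rel lfunDZ !tensDl opprD addrACA -scalerBr.
  by apply: memvD; [apply: memvZ; apply: IHx|apply: IHy].
elim/vbasis_ind=> [a|c phi psi IHx IHy a|phi phiB].
- rewrite /tens_rel (_ : dual_lact a 0 = 0); last first.
    by apply/lfunP=> b; rewrite dual_lactE !zero_lfunE.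
  by rewrite !tens0r subrr mem0v.
- rewrite /tens_rel dual_lactDr !tensDr opprD addrACA -scalerBr.
  by apply: memvD; [apply: memvZ; apply: IHx|apply: IHy].
elim/vbasis_ind=> [|c a b IHx IHy|a aB].
- rewrite /tens_rel ract0r (_ : dual_lact 0 phi = 0); last first.
    by apply/lfunP=> b; rewrite dual_lactE mulr0 lfun0 zero_lfunE.
  by rewrite tens0l tens0r subrr mem0v.
- rewrite /tens_rel ractDr ractZr dual_lactDl tensDl tensDr opprD addrACA -scalerBr.
  by apply: memvD; [apply: memvZ; apply: IHx|apply: IHy].
apply: memv_span; apply/allpairsP; exists ((x, phi), a); split=> //.
by apply/allpairsP; exists (x, phi); split.
Qed.

Lemma balancing_sub M (W : {vspace 'Hom(A, M)}) :
  (forall (x : M) phi a, tens_rel x phi a \in W) -> (balancing M <= W)%VS.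
Proof.
move=> h; apply/span_subvP=> _ /allpairsP[[[x phi] a] /= [_ _ ->]].
exact: h.
Qed.

Lemma tens_ract_linear M b : linear (@tens_ract k A M b).
Proof.
move=> c s t; apply/lfunP=> u.
by rewrite add_lfunE scale_lfunE !tens_ractE add_lfunE scale_lfunE.
Qed.

Lemma balancing_stable M b (t : 'Hom(A, M)) :
  t \in balancing M -> tens_ract b t \in balancing M.
Proof.
rewrite -(linfunE (@tens_ract_linear M b)) memv_preim; move: t; apply/subvP.
apply: balancing_sub => x phi a; rewrite -memv_preim (linfunE (@tens_ract_linear M b)).
suff -> : tens_ract b (tens_rel x phi a) = tens_rel x (linfun (fun u => phi (b * u))) a.
  exact: tens_rel_mem.
have E u : linfun (fun u => phi (b * u)) u = phi (b * u).
  by apply: linfunE => c v w; rewrite mulrDr -scalerAr lfunDZ.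
apply/lfunP=> u; rewrite tens_ractE !add_lfunE !opp_lfunE !tensE.
by rewrite !dual_lactE !E mulrA.
Qed.

(** The trace of f t. Under this pairing the linear forms on V (x) DA are the maps
    from V to A, and those on M (x)_A DA are the A-linear maps from M to A. *)
Definition pairing (V : vectType k) (f : 'Hom(V, A)) (t : 'Hom(A, V)) : k :=
  \sum_(i < \dim {:A}) coord (vbasis {:A}) i (f (t (vbasis {:A})`_i)).

Lemma pairing_linear V (f : 'Hom(V, A)) :
  linear (pairing f : 'Hom(A, V) -> k^o).
Proof.
move=> c s t; rewrite /pairing scaler_sumr -big_split; apply: eq_bigr => i _ /=.
by rewrite add_lfunE scale_lfunE lfunDZ linearP.
Qed.

Lemma pairingB V (f : 'Hom(V, A)) s t :
  pairing f (s - t) = pairing f s - pairing f t.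
Proof.
rewrite /pairing -sumrB; apply: eq_bigr => i _.
by rewrite add_lfunE opp_lfunE lfunB linearB.
Qed.

Definition pairingf V (f : 'Hom(V, A)) : 'Hom('Hom(A, V), k^o) :=
  linfun (pairing f : 'Hom(A, V) -> k^o).

Lemma pairingfE V (f : 'Hom(V, A)) t : pairingf f t = pairing f t.
Proof. by rewrite linfunE //; exact: pairing_linear. Qed.

Lemma mem_lker_pairing V (f : 'Hom(V, A)) t :
  reflect (pairing f t = 0) (t \in lker (pairingf f)).
Proof. by rewrite memv_ker pairingfE; exact: eqP. Qed.

Lemma pairing_tens M (f : 'Hom(M, A)) (x : M) phi : pairing f (tens x phi) = phi (f x).
Proof.
rewrite [in RHS](coord_vbasis (memvf (f x))) linear_sum; apply: eq_bigr => i _.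
by rewrite tensE !linearZ /= mulrC.
Qed.

Lemma pairing_comp V W (f : 'Hom(V, A)) (d : 'Hom(W, V)) (t : 'Hom(A, W)) :
  pairing f (d \o t)%VF = pairing (f \o d)%VF t.
Proof. by apply: eq_bigr => i _; rewrite !comp_lfunE. Qed.

Lemma trace_cyclic (f g : 'End(A)) : pairing f g = pairing g f.
Proof.
rewrite /pairing.
transitivity (\sum_(i < \dim {:A}) \sum_(j < \dim {:A})
    coord (vbasis {:A}) j (g (vbasis {:A})`_i) *
    coord (vbasis {:A}) i (f (vbasis {:A})`_j)).
  apply: eq_bigr => i _; rewrite {1}(coord_vbasis (memvf (g _))) !linear_sum.
  by apply: eq_bigr => j _; rewrite !linearZ.
rewrite exchange_big; apply: eq_bigr => i _.
rewrite [in RHS](coord_vbasis (memvf (f _))) !linear_sum.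
by apply: eq_bigr => j _; rewrite !linearZ /= mulrC.
Qed.

(** As the trace is cyclic, the right action of A on DA becomes left
    multiplication on A. *)
Lemma pairing_ract M b (f : 'Hom(M, A)) (t : 'Hom(A, M)) :
  pairing f (tens_ract b t) = pairing (amull b \o f)%VF t.
Proof.
have -> : tens_ract b t = (t \o amull b)%VF.
  by apply/lfunP=> u; rewrite tens_ractE comp_lfunE lfunE.
by rewrite pairing_comp trace_cyclic pairing_comp.
Qed.

Lemma pairing_balancing M (f : 'Hom(M, regmod A)) (t : 'Hom(A, M)) :
  is_hom f -> t \in balancing M -> pairing f t = 0.
Proof.
move=> hf tB; apply/mem_lker_pairing; move: t tB; apply/subvP.
apply: balancing_sub => x phi a; apply/mem_lker_pairing.
by rewrite pairingB !pairing_tens dual_lactE hf regmodE subrr.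
Qed.

Lemma pairing_rep M (psi : 'Hom('Hom(A, M), k^o)) :
  exists f : 'Hom(M, regmod A), forall (x : M) phi, psi (tens x phi) = phi (f x).
Proof.
pose F (x : M) : A := \sum_i psi (tens x (coordf i)) *: (vbasis {:A})`_i.
have lF : linear F.
  move=> c x y; rewrite /F scaler_sumr -big_split; apply: eq_bigr => i _ /=.
  by rewrite tensDl lfunDZ scalerDl scalerA.
exists (linfun F) => x phi; rewrite (linfunE lF) linear_sum /=.
have phiE : phi = \sum_(i < \dim {:A}) phi (vbasis {:A})`_i *: coordf i.
  apply/lfunP=> b; rewrite {1}(coord_vbasis (memvf b)) linear_sum sum_lfunE /=.
  by apply: eq_bigr => i _; rewrite lfunZ scale_lfunE coordfE; exact: mulrC.
have tens_lin : linear (fun phi => tens x phi) by move=> c u v; rewrite tensDr.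
rewrite {1}phiE -(linfunE tens_lin) !linear_sum; apply: eq_bigr => i _ /=.
by rewrite !lfunZ (linfunE tens_lin); exact: mulrC.
Qed.

Lemma pairing_rep_hom M (psi : 'Hom('Hom(A, M), k^o)) :
    (forall t, t \in balancing M -> psi t = 0) ->
  exists2 f : 'Hom(M, regmod A), is_hom f &
    forall (x : M) phi, psi (tens x phi) = phi (f x).
Proof.
move=> psi0; have [f fE] := pairing_rep psi; exists f => // x a.
apply: dual_sep => phi; rewrite -fE regmodE -dual_lactE -fE.
by apply: subr0_eq; rewrite -lfunB psi0 ?tens_rel_mem.
Qed.

End TraceDuality.

(** * Duality between Tor with values in DA and Ext with values in A *)

Section SerreStable.
Variables (k : fieldType) (A : falgType k) (M : rmodule A) (P : proj_resolution M).
Local Notation DA := 'Hom(A, k^o).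
Local Notation aug := (pr_aug P).
Local Notation d := (pr_diff P).
Local Notation RA := (regmod A).

Lemma resolution_d0 (x : pr_obj P 1) : aug (d 0 x) = 0.
Proof. by apply/eqP; rewrite -memv_ker -pr_exact0 memv_img ?memvf. Qed.

Lemma resolution_dS i (x : pr_obj P i.+2) : d i (d i.+1 x) = 0.
Proof. by apply/eqP; rewrite -memv_ker -pr_exactS memv_img ?memvf. Qed.

Lemma tor_diffE i t : tor_diff P i t = (d i \o t)%VF.
Proof.
apply: linfunE => c u v; apply/lfunP=> a.
by rewrite !(add_lfunE, scale_lfunE, comp_lfunE) lfunDZ.
Qed.

Lemma mem_tor_cycles i t :
  (t \in tor_cycles P i.+1) = ((d i \o t)%VF \in balancing (pr_obj P i)).
Proof. by rewrite /= -memv_preim tor_diffE. Qed.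

Lemma tor_cycles_stable i b t :
  t \in tor_cycles P i.+1 -> tens_ract b t \in tor_cycles P i.+1.
Proof.
rewrite !mem_tor_cycles => /(balancing_stable b).
have -> // : tens_ract b (d i \o t)%VF = (d i \o tens_ract b t)%VF.
by apply/lfunP=> a; rewrite tens_ractE !comp_lfunE tens_ractE.
Qed.

Section TorZero.
Hypothesis T0 : tor_eq0 P 0.

(** The space Tor_0(M, DA) = M (x)_A DA is dual to Hom(M, A). *)
Lemma hom_regular0 (f : 'Hom(M, RA)) : is_hom f -> f = 0.
Proof.
move=> hf; pose F := (f \o aug)%VF.
have hF : is_hom (F : 'Hom(pr_obj P 0, RA)).
  by move=> x a; rewrite !comp_lfunE pr_aug_hom hf.
have F0 : (fullv <= lker (pairingf F))%VS.
  apply: (subv_trans T0); rewrite subv_add; apply/andP; split; apply/subvP=> t.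
    case/memv_imgP=> s _ ->; apply/mem_lker_pairing.
    rewrite tor_diffE pairing_comp /pairing big1 // => i _.
    by rewrite !comp_lfunE resolution_d0 lfun0 linear0.
  by move=> tB; apply/mem_lker_pairing; apply: pairing_balancing.
apply/lfunP=> x; rewrite zero_lfunE.
have /memv_imgP[y _ ->] : x \in limg aug by rewrite pr_aug_onto memvf.
apply: dual_sep => phi; rewrite lfun0 -comp_lfunE -pairing_tens.
by have /mem_lker_pairing := subvP F0 (tens y phi) (memvf _).
Qed.

(** This is half of the duality between Tor_1(M, DA) and Ext^1(M, A). The form
    which f induces on the boundaries in degree 0 is defined on all of
    P_0 (x)_A DA, since Tor_0 vanishes; so it is given by a map f'. *)
Lemma coboundary_of_pairing0 (f : 'Hom(pr_obj P 1, RA)) :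
    (forall t, t \in tor_cycles P 1 -> pairing f t = 0) ->
  exists2 f' : 'Hom(pr_obj P 0, RA), is_hom f' & f = (f' \o d 0)%VF.
Proof.
move=> f0; have [t|psi [psiE psi0]] := factor_modulo (psi := pairingf f) T0.
  by rewrite tor_diffE -mem_tor_cycles pairingfE => /f0.
have [f' hf' f'E] := pairing_rep_hom psi0; exists f' => //.
apply/lfunP=> x; rewrite comp_lfunE; apply: dual_sep => phi.
rewrite -f'E -pairing_tens -pairingfE -psiE; congr (psi _).
by apply/lfunP=> a; rewrite tor_diffE comp_lfunE !tensE lfunZ.
Qed.

End TorZero.
End SerreStable.

(** * Maps from a Serre stable module to a cokernel of projectives *)

Section SerreStableCokernel.
Variables (k : fieldType) (A : falgType k).
Local Notation RA := (regmod A).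

(** The map M -> N = eA / bA is encoded by its kernel U and an element x which goes
    to the class of e: then a |-> xa identifies N with M / U. If h lifts M -> N to
    P_0 -> eA, then h d_0 takes values in bA, and h d_0 = b f for a cocycle f with
    values in e'A. This is the connecting map. Since Hom(M, A) = 0, the cocycle f
    is no coboundary, and defines a nonzero form on M = Tor_1(M, DA) that only sees
    Me'; but b f is a coboundary, so that this form vanishes on Mb. *)
Theorem serre_stable_coker (M : rmodule A) (e e' b : A) (U : submodule M) (x : M) :
    serre_stable M -> e * e = e -> e' * e' = e' -> e * b = b -> b * e' = b ->
    (forall a, e' * a = a -> b * a = 0 -> a = 0) ->
    x |> e = x -> x \notin U -> x |> b \in U ->
    (forall y, exists a, y - x |> a \in U) ->
    (forall a, e * a = a -> x |> a \in U -> exists a', a = b * a') ->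
  limg (ract M b) <> limg (ract M e').
Proof.
case=> P [[phi [phi_onto phi_ker phi_act]] /(_ 0 isT) T0] ee e'e' eb be' b_inj.
move=> xe xU xbU xgen xker limE.
pose d := pr_diff P; pose aug := pr_aug P.
pose G : 'Hom(RA, quomod U) := linfun (fun a : RA => quo_map U (x |> a)).
have GE (a : A) : G a = quo_map U (x |> a).
  by apply: linfunE => c u v; rewrite ractDr ractZr lfunDZ.
have G_hom : is_hom G by move=> a c; rewrite GE regmodE ractMr [LHS]quo_map_hom GE.
have G_onto : limg G = fullv.
  apply/eqP; rewrite eqEsubv subvf; apply/subvP=> u _.
  have [a aE] := xgen (vsval u); apply/memv_imgP; exists (a : RA); rewrite ?memvf //.
  by rewrite GE -[u]quo_mapK; apply/eqP; rewrite quo_map_eq.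
pose F : 'Hom(pr_obj P 0, quomod U) := (quo_map U \o aug)%VF.
have FE u : F u = quo_map U (aug u) by exact: comp_lfunE.
have F_hom : is_hom F.
  by move=> u a; rewrite !FE pr_aug_hom [LHS]quo_map_hom.
have [h h_hom hF] := @pr_projective _ _ _ P 0 _ _ _ _ G_hom G_onto F_hom.
pose h1 : 'Hom(pr_obj P 0, RA) := (amull e \o h)%VF.
have h1E u : h1 u = e * (h u : A) by rewrite comp_lfunE amullE.
have h1_hom : is_hom h1 by move=> u a; rewrite !h1E h_hom !regmodE mulrA.
have e_h1 u : e * (h1 u : A) = h1 u by rewrite h1E mulrA ee.
have xh1 u : aug u - x |> (h1 u : A) \in U.
  rewrite -quo_map_eq h1E ractMr xe -GE -[G _](comp_lfunE G h).
  by rewrite hF FE.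
have xh1d u : x |> (h1 (d 0 u) : A) \in U.
  by have := xh1 (d 0 u); rewrite resolution_d0 add0r memvN.
pose f : 'Hom(pr_obj P 1, RA) := (amull e' \o (amull b)^-1 \o h1 \o d 0)%VF.
have fE u : f u = e' * (amull b)^-1%VF (h1 (d 0 u)).
  by rewrite 3!comp_lfunE amullE.
have e_f u : e' * (f u : A) = f u.
  by rewrite fE mulrA e'e'.
have b_f u : b * (f u : A) = h1 (d 0 u).
  have [a' a'E] := xker _ (e_h1 (d 0 u)) (xh1d u).
  have bVK : amull b ((amull b)^-1%VF (h1 (d 0 u))) = h1 (d 0 u).
    by apply: limg_lfunVK; apply/limg_amullP; exists a'.
  by rewrite fE mulrA be' -[RHS]bVK amullE.
have b_injB a c : e' * a = a -> e' * c = c -> b * a = b * c -> a = c.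
  move=> ea ec /eqP; rewrite -subr_eq0 -mulrBr => /eqP e0.
  by apply: subr0_eq; apply: b_inj e0; rewrite mulrBr ea ec.
have f_hom : is_hom f.
  move=> u a; rewrite regmodE; apply: b_injB; rewrite ?e_f ?mulrA ?e_f //.
  by rewrite !b_f pr_diff_hom h1_hom regmodE.
have fd u : f (d 1%N u) = 0.
  apply: b_injB; rewrite ?e_f ?mulr0 // b_f resolution_dS.
  exact: lfun0.
(* If f = f' d_0, then h1 - b f' factors through a map from M to A, which is zero;
   then M -> N would be zero, as it lifts to h1. *)
have f_noncob f' : @is_hom _ A (pr_obj P 0) RA f' -> f <> (f' \o d 0)%VF.
  move=> f'_hom fE'; pose g : 'Hom(pr_obj P 0, RA) := h1 - (amull b \o f')%VF.
  have gE u : g u = (h1 u : A) - b * (f' u : A).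
    by rewrite add_lfunE opp_lfunE [(amull b \o f')%VF u]comp_lfunE amullE.
  have g_hom : is_hom g.
    by move=> u a; rewrite !gE !regmodE h1_hom f'_hom !regmodE mulrBl mulrA.
  have gd u : g (d 0 u) = 0.
    by rewrite gE -b_f fE' comp_lfunE subrr.
  have g0 u : aug u = 0 -> g u = 0.
    move=> /eqP; rewrite -memv_ker -pr_exact0 => /memv_imgP[w _ ->]; exact: gd.
  have augK y : aug ((aug^-1)%VF y) = y by rewrite limg_lfunVK // pr_aug_onto memvf.
  have gaug u : g ((aug^-1)%VF (aug u)) = g u.
    by apply: subr0_eq; rewrite -lfunB g0 // lfunB augK subrr.
  pose gM : 'Hom(M, RA) := (g \o aug^-1)%VF.
  have gME y : gM y = g (aug^-1%VF y) by exact: comp_lfunE.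
  have gM0 : gM = 0.
    apply: (hom_regular0 T0) => y a; rewrite !gME -g_hom -[RHS]gaug.
    by rewrite [aug _]pr_aug_hom augK.
  have gz u : g u = 0 by rewrite -gaug -gME gM0 zero_lfunE.
  have augU u : aug u \in U.
    have h1z : (h1 u : A) = b * (f' u : A) by apply: subr0_eq; rewrite -gE gz.
    rewrite -(subrK (x |> (h1 u : A)) (aug u)) memvD ?xh1 //.
    by rewrite h1z ractMr sub_stable.
  by case/negP: xU; rewrite -(augK x) augU.
case: (boolP (tor_cycles P 1 <= lker (pairingf f))%VS).
  move=> /subvP Zf; have [|f' f'_hom] := coboundary_of_pairing0 T0 (f := f).
    by move=> t /Zf/mem_lker_pairing.
  exact: f_noncob.
case/subvPn=> t tZ; case/mem_lker_pairing.
(* A cycle t on which f does not vanish. If Mb = Me', then t e' is homologous to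
   s b for some cycle s, where f vanishes. *)
have : phi t |> e' \in limg (ract M b) by rewrite limE memv_img ?memvf.
case/memv_imgP=> y _ tyE.
have /memv_imgP[s sZ yE] : y \in (phi @: tor_cycles P 1)%VS by rewrite phi_onto memvf.
have rZ : tens_ract e' t - tens_ract b s \in tor_cycles P 1.
  by rewrite memvB ?tor_cycles_stable.
have : tens_ract e' t - tens_ract b s \in tor_boundaries P 1.
  rewrite -phi_ker memv_cap rZ memv_ker lfunB !phi_act //.
  by rewrite tyE yE subrr eqxx.
case/memv_addP=> _ /memv_imgP[w _ ->] [v vB] rE.
have : pairing f (tens_ract e' t - tens_ract b s) = 0.
  apply/mem_lker_pairing; rewrite rE memvD //; apply/mem_lker_pairing.
    rewrite tor_diffE pairing_comp /pairing big1 // => i _.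
    by rewrite comp_lfunE fd linear0.
  exact: pairing_balancing.
rewrite pairingB !pairing_ract.
have -> : (amull e' \o f)%VF = f.
  by apply/lfunP=> u; rewrite comp_lfunE amullE e_f.
have -> : (amull b \o f)%VF = (h1 \o d 0)%VF.
  apply/lfunP=> u; rewrite [LHS]comp_lfunE amullE b_f.
  exact/esym/comp_lfunE.
rewrite -(pairing_comp h1 (d 0) s) (pairing_balancing h1_hom) ?subr0 //.
by have := sZ; rewrite mem_tor_cycles.
Qed.

End SerreStableCokernel.

(** * The Euler form of a cokernel of projectives *)

Section EulerForm.
Variables (k : fieldType) (A : falgType k).
Local Notation RA := (regmod A).
Implicit Types (N : rmodule A) (a : A).

Lemma right_ideal_gen (e : A) : e * e = e -> e \in right_ideal e.
Proof. by move=> ee; apply/limg_amullP; exists e. Qed.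

Lemma mem_right_ideal (e a : A) : e * e = e -> (a \in right_ideal e) = (e * a == a).
Proof.
move=> ee; apply/limg_amullP/eqP => [[y ->]|<-]; last by exists a.
by rewrite mulrA ee.
Qed.

Lemma dim_hom_eproj (e : A) N : e * e = e ->
  \dim (hom_space (eproj e) N) = \dim (limg (ract N e)).
Proof.
move=> ee; have eI := right_ideal_gen ee.
pose g : eproj e := vsproj (right_ideal e) e.
have gE : vsval g = e by rewrite vsprojK.
have gen (y : eproj e) : y = g |> vsval y.
  apply: subvs_inj; rewrite vsval_act gE regmodE; apply/esym/eqP.
  by rewrite -mem_right_ideal ?subvsP.
pose ev : 'Hom('Hom(eproj e, N), N) := linfun (fun f : 'Hom(eproj e, N) => f g).
have evE (f : 'Hom(eproj e, N)) : ev f = f g.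
  by apply: linfunE => c f1 f2; rewrite add_lfunE scale_lfunE.
rewrite -(@limg_dim_eq _ _ _ ev); last first.
  apply/eqP; rewrite -subv0; apply/subvP=> f; rewrite memv_cap memv0 memv_ker evE.
  case/andP=> /mem_hom_space hf /eqP f0; apply/eqP/lfunP=> y.
  by rewrite [y]gen hf f0 lfun0 zero_lfunE.
congr (\dim _); apply/eqP; rewrite eqEsubv; apply/andP; split; apply/subvP=> y.
  case/memv_imgP=> f /mem_hom_space hf ->; rewrite evE [g in f g]gen hf gE.
  by rewrite memv_img ?memvf.
case/memv_imgP=> x _ ->; clear y.
pose f : 'Hom(eproj e, N) := linfun (fun y : eproj e => x |> vsval y).
have fE y : f y = x |> vsval y.
  by apply: linfunE => c a b; rewrite linearP add_lfunE scale_lfunE.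
apply/memv_imgP; exists f; last by rewrite evE fE gE.
by apply/mem_hom_space=> z a; rewrite !fE vsval_act regmodE ractMr.
Qed.

Section TwoTermResolution.
Variables (e e' u : A).
Hypotheses (ee : e * e = e) (e'e' : e' * e' = e') (eu : e * u = u) (ue' : u * e' = u).
Hypothesis u_inj : forall a, e' * a = a -> u * a = 0 -> a = 0.

(** The cokernel of u : e'A -> eA is formed as a quotient of A, which is mapped
    onto eA by left multiplication by e. *)
Definition coker_space : {vspace RA} := (amull e @^-1: limg (amull u))%VS.

Lemma mem_coker_space a : reflect (exists b, e * a = u * b) (a \in coker_space).
Proof. by rewrite -memv_preim amullE; apply: limg_amullP. Qed.

Lemma coker_space_stable a (x : RA) : x \in coker_space -> x |> a \in coker_space.
Proof.
move=> /mem_coker_space[b xE]; apply/mem_coker_space; exists (b * a).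
by rewrite regmodE !mulrA xE.
Qed.

Definition coker_sub : submodule RA := Submodule coker_space_stable.
Definition cokmod : rmodule A := quomod coker_sub.

Definition res_idem (i : nat) : A := match i with 0 => e | 1 => e' | _ => 0 end.
Definition res_step (i : nat) : A := if i is 0 then u else 0.

Lemma res_idemK i : res_idem i * res_idem i = res_idem i.
Proof. by case: i => [|[|i]] //=; rewrite mulr0. Qed.

Lemma res_idem_step i : res_idem i * res_step i = res_step i.
Proof. by case: i => [|i] //=; rewrite mulr0. Qed.

Definition res_obj i := eproj (res_idem i).

Lemma res_step_in i (a : A) : res_step i * a \in right_ideal (res_idem i).
Proof. by rewrite mem_right_ideal ?res_idemK // mulrA res_idem_step. Qed.

Definition res_diff i : 'Hom(res_obj i.+1, res_obj i) :=
  linfun (fun y : res_obj i.+1 =>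
    vsproj (right_ideal (res_idem i)) (res_step i * vsval y) : res_obj i).

Lemma res_diffE i y : vsval (res_diff i y) = res_step i * vsval y.
Proof.
rewrite [X in vsval X]linfunE ?vsprojK ?res_step_in // => c v w.
by rewrite linearP mulrDr -scalerAr linearP.
Qed.

Definition res_aug : 'Hom(res_obj 0, cokmod) :=
  (quo_map coker_sub \o linfun vsval)%VF.

Lemma res_augE (y : res_obj 0) : res_aug y = quo_map coker_sub (vsval y).
Proof.
by rewrite [LHS]comp_lfunE; congr (quo_map _ _); apply: linfunE => c v w; rewrite linearP.
Qed.

Lemma res_obj0 i (y : res_obj i.+2) : y = 0.
Proof.
apply: subvs_inj; rewrite linear0; have := subvsP y.
by rewrite mem_right_ideal ?mulr0 //= mul0r eq_sym => /eqP.
Qed.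

Lemma res_diff_hom i : is_hom (res_diff i).
Proof.
by move=> x a; apply: subvs_inj; rewrite vsval_act !res_diffE vsval_act !regmodE mulrA.
Qed.

Lemma res_aug_hom : is_hom res_aug.
Proof.
by move=> x a; rewrite !res_augE vsval_act; apply: (@quo_map_hom _ _ RA coker_sub).
Qed.

Lemma res_aug_onto : limg res_aug = fullv.
Proof.
apply/eqP; rewrite eqEsubv subvf; apply/subvP=> y _.
have eaI : e * vsval y \in right_ideal e by apply/limg_amullP; exists (vsval y).
apply/memv_imgP; exists (vsproj (right_ideal e) (e * vsval y)); rewrite ?memvf //.
rewrite res_augE vsprojK // -[LHS]quo_mapK; apply/eqP; rewrite quo_map_eq.
by apply/mem_coker_space; exists 0; rewrite mulr0 mulrBr mulrA ee subrr.
Qed.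

Lemma res_exact0 : limg (res_diff 0) = lker res_aug.
Proof.
apply/eqP; rewrite eqEsubv; apply/andP; split; apply/subvP=> y.
  case/memv_imgP=> x _ ->; rewrite memv_ker res_augE quo_map_eq0 res_diffE.
  by apply/mem_coker_space; exists (vsval x); rewrite mulrA eu.
rewrite memv_ker res_augE quo_map_eq0 => /mem_coker_space[b yE].
have yK : e * vsval y = vsval y by apply/eqP; rewrite -mem_right_ideal ?subvsP.
have bI : e' * b \in right_ideal e' by apply/limg_amullP; exists b.
apply/memv_imgP; exists (vsproj (right_ideal e') (e' * b)); rewrite ?memvf //.
by apply: subvs_inj; rewrite res_diffE vsprojK //= mulrA ue' -yE yK.
Qed.

Lemma res_exactS i : limg (res_diff i.+1) = lker (res_diff i).
Proof.
apply/eqP; rewrite eqEsubv; apply/andP; split; apply/subvP=> y.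
  by case/memv_imgP=> x _ ->; rewrite [x]res_obj0 lfun0 mem0v.
rewrite memv_ker => /eqP y0; suff -> : y = 0 by apply: mem0v.
case: i y y0 => [|i] y y0; last exact: res_obj0.
apply: subvs_inj; rewrite linear0; apply: u_inj.
  by apply/eqP; rewrite -mem_right_ideal ?subvsP.
by rewrite -[u]/(res_step 0) -res_diffE y0 linear0.
Qed.

Definition two_term_resolution : proj_resolution cokmod :=
  ProjResolution (fun i => eproj_projective (res_idemK i)) res_diff_hom
    res_aug_hom res_aug_onto res_exact0 res_exactS.

(** As Hom(eA, N) = Ne, the complex that computes Ext(X, N) is Ne -> Ne', whose Euler
    characteristic does not depend on the map. *)
Lemma euler_form_cokmod N :
  euler_form cokmod N
    ((\dim (limg (ract N e)))%:Z - (\dim (limg (ract N e')))%:Z).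
Proof.
exists two_term_resolution, 2%N; split.
  case=> [|[|i]] // _; apply/eqP; rewrite -leqn0 leq_subLR addn0.
  rewrite (leq_trans (dimvS (capvSl _ _))) // dim_hom_eproj ?mulr0 //.
  rewrite (_ : ract N 0 = 0) ?lim0g ?dimv0 //.
  exact: linear0.
rewrite 2!big_ord_recr big_ord0 /= add0r expr0 mul1r expr1 mulN1r.
have dE i (f : 'Hom(res_obj i, N)) : ext_diff N two_term_resolution i f = (f \o res_diff i)%VF.
  apply: linfunE => c f1 f2; apply/lfunP=> y.
  by rewrite !(comp_lfunE, add_lfunE, scale_lfunE).
pose H0 := hom_space (res_obj 0) N; pose H1 := hom_space (res_obj 1) N.
pose D := ext_diff N two_term_resolution 0.
have H01 : (D @: H0 <= H1)%VS.
  apply/subvP=> _ /memv_imgP[f /mem_hom_space hf ->].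
  apply/mem_hom_space=> y a; rewrite dE !comp_lfunE.
  by rewrite res_diff_hom hf.
have -> : ext_dim N two_term_resolution 0 = \dim (H0 :&: lker D).
  by rewrite /ext_dim dimv0 subn0.
have -> : ext_dim N two_term_resolution 1 = (\dim H1 - \dim (D @: H0))%N.
  rewrite /ext_dim; congr (\dim _ - _)%N; apply/capv_idPl/subvP=> f _.
  rewrite memv_ker dE; apply/eqP/lfunP=> y.
  by rewrite [y]res_obj0 !lfun0.
have -> : \dim (limg (ract N e)) = \dim H0 by rewrite [RHS]dim_hom_eproj.
have -> : \dim (limg (ract N e')) = \dim H1 by rewrite [RHS]dim_hom_eproj.
rewrite -(limg_ker_dim D H0) -subzn ?dimvS // PoszD opprB.
by rewrite -addrA.
Qed.

End TwoTermResolution.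
End EulerForm.

(** * Path algebras *)

Section PathElements.
Variables (k : fieldType) (Q : quiver).
Local Notation kQ := (path_algebra k Q).
Local Notation pe := (@path_elt k Q).

Lemma pa_coefD (f g : kQ) r : (f + g) r = (f r : k) + (g r : k) :> k. Proof. exact: ffunE. Qed.
Lemma pa_coefN (f : kQ) r : (- f) r = - (f r : k) :> k. Proof. exact: ffunE. Qed.
Lemma pa_coefZ c (f : kQ) r : (c *: f) r = c * (f r : k) :> k. Proof. exact: ffunE. Qed.
Lemma pa_coef0 r : (0 : kQ) r = 0 :> k. Proof. exact: ffunE. Qed.
Lemma pa_coef_sum (I : finType) (F : I -> kQ) r : (\sum_i F i) r = \sum_i (F i r : k) :> k.
Proof. exact: sum_ffunE. Qed.
Definition pa_coefE := (pa_coefD, pa_coefN, pa_coefZ, pa_coef0).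

Lemma path_elt_mul v s w t :
  pe v s * pe w t = if walk_end v s == w then pe v (s ++ t) else 0.
Proof.
apply/ffunP=> r; rewrite [LHS]pa_mulE.
pose C p q := [&& (qstart p == v) && (qarrows p == s),
                  (qstart q == w) && (qarrows q == t) & is_concat p q r].
have termE p q : (pe v s p * pe w t q) *+ is_concat p q r = (C p q)%:R.
  rewrite !ffunE /C; case: (_ && _); rewrite ?mul0r ?mul0rn // mul1r /=.
  by case: (_ && _); rewrite ?mul0rn // -mulrnA mulnbr; case: ifP.
have CP p q : C p q -> walk_end v s = w /\ (qstart r == v) && (qarrows r == s ++ t).
  case/and3P=> /andP[/eqP <- /eqP <-] /andP[/eqP <- /eqP <-].
  by case/and3P=> /eqP -> /eqP <- /eqP ->; rewrite !eqxx.
under eq_bigr => p _ do under eq_bigr => q _ do rewrite termE.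
have Z : ~~ ((walk_end v s == w) && ((qstart r == v) && (qarrows r == s ++ t))) ->
    \sum_p \sum_q ((C p q)%:R : k) = 0.
  move=> nb; rewrite big1 // => p _; rewrite big1 // => q _.
  by case: (boolP (C p q)) nb => // /CP[-> ->]; rewrite eqxx.
case: eqP => [we|/eqP we]; last by rewrite Z ?(negPf we) // ffunE.
rewrite ffunE; case: (boolP (_ && _)) => b; last by rewrite Z // we eqxx.
have [/eqP rv /eqP rs] := andP b.
have := qpath_walk r; rewrite rv rs walk_cat => /andP[ws wt].
have := qpath_size r; rewrite rs size_cat => sz.
have [p p1 p2] := qpath_exists ws (leq_trans (leq_addr _ _) sz).
have [q q1 q2] := qpath_exists wt (leq_trans (leq_addl _ _) sz).
have Cpq : C p q.
  by rewrite /C /is_concat p1 p2 q1 q2 rv rs -we /qend p1 p2 !eqxx.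
rewrite (bigD1 p) //= (bigD1 q) //= Cpq !big1 ?addr0 // => [p' ne|q' ne].
  rewrite big1 // => q' _; case: (boolP (C p' q')) => //.
  case/and3P=> /andP[/eqP e1 /eqP e2] _ _; case/eqP: ne.
  by apply: qpath_eq; congruence.
case: (boolP (C p q')) => // /and3P[_ /andP[/eqP e1 /eqP e2] _]; case/eqP: ne.
by apply: qpath_eq; congruence.
Qed.

Lemma path_elt_decomp (f : kQ) : f = \sum_r f r *: pe (qstart r) (qarrows r).
Proof.
apply/ffunP=> r; rewrite sum_ffunE (bigD1 r) //= big1 => [|q ne]; last first.
  rewrite !ffunE; case: andP => [[/eqP e1 /eqP e2]|_]; last exact: mulr0.
  by case/eqP: ne; apply: qpath_eq.
by rewrite !ffunE !eqxx addr0 [_ *: _]mulr1.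
Qed.

Lemma path_elt_ind (S : kQ -> Prop) : S 0 ->
    (forall c f g, S f -> S g -> S (c *: f + g)) ->
    (forall v s, walk v s -> S (pe v s)) -> forall f, S f.
Proof.
move=> S0 SD Sp f; rewrite [f]path_elt_decomp; elim/big_rec: _ => // r g _ Sg.
by apply: SD => //; apply/Sp/qpath_walk.
Qed.

Lemma sum_path_elt_nil : \sum_v pe v [::] = 1.
Proof.
apply/ffunP=> r; rewrite sum_ffunE ffunE (bigD1 (qstart r)) //= big1 => [|v ne].
  by rewrite ffunE eqxx addr0.
by rewrite ffunE eq_sym (negPf ne).
Qed.

Lemma path_elt_cons (a : arrow Q) s :
  pe (src a) (a :: s) = pe (src a) [:: a] * pe (tgt a) s.
Proof. by rewrite path_elt_mul /walk_end /= eqxx. Qed.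

End PathElements.

(** * The vertices of the canonical quiver *)

Section CanonicalQuiver.
Variables (m : nat) (p : 'I_m.+2 -> nat).
Hypothesis p_gt0 : forall i, (0 < p i)%N.
Local Notation av := (arm_vertex p).

Lemma arm_positionP i l : (l <= p i)%N -> [\/ l = 0, l = p i | (0 < l < p i)%N].
Proof.
rewrite leq_eqVlt => /predU1P[|lp]; first by constructor 2.
by case: l lp => [|l] lp; [constructor 1|constructor 3].
Qed.

Lemma arm_vertex_sink i j : (p i <= j)%N -> av i j = can_sink p.
Proof.
case: j => [|j] pj; first by rewrite leqNgt p_gt0 in pj.
by rewrite /arm_vertex insubF // -ltnS prednK // ltnNge pj.
Qed.

Lemma arm_vertex_inner i (l : 'I_(p i).-1) :
  av i l.+1 = inr (Tagged (fun i => 'I_(p i).-1) l).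
Proof. by rewrite /arm_vertex valK. Qed.

Lemma inner_exists i j : (0 < j < p i)%N -> exists l : 'I_(p i).-1, j = l.+1.
Proof.
case: j => // j /= jp; have jl : (j < (p i).-1)%N by rewrite -ltnS prednK.
by exists (Ordinal jl).
Qed.

Lemma arm_vertex_eq i l i' l' : (l <= p i)%N -> (l' <= p i')%N -> av i l = av i' l' ->
  [\/ i = i' /\ l = l', l = 0 /\ l' = 0 | l = p i /\ l' = p i'].
Proof.
move=> /arm_positionP + /arm_positionP.
case=> [->|->|/inner_exists[a ->]]; case=> [->|->|/inner_exists[b ->]];
  rewrite ?arm_vertex_inner ?(arm_vertex_sink (leqnn _)) //.
- by move=> _; constructor 2.
- by move=> _; constructor 3.
pose pos (v : can_vertex p) := if v is inr t then (tag t, tagged t : nat) else (i, 0).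
by move=> /(congr1 pos)[ei ab]; constructor 1; split=> //; congr _.+1.
Qed.

Lemma arm_vertex_eq_source i l : (l <= p i)%N -> (av i l == can_source p) = (l == 0).
Proof.
move=> lp; apply/eqP/eqP => [e|-> //].
have [[_ ->]|[-> _]|[_ z]] // := arm_vertex_eq lp (leq0n _) (e : _ = av i 0).
by have := p_gt0 i; rewrite -z.
Qed.

Lemma arm_vertex_eq_sink i l : (l <= p i)%N -> (av i l == can_sink p) = (l == p i).
Proof.
move=> lp; apply/eqP/eqP => [e|->]; last exact: arm_vertex_sink.
rewrite -(arm_vertex_sink (leqnn (p i))) in e.
have [[_ ->]|[_ z]|[->]] // := arm_vertex_eq lp (leqnn _) e.
by have := p_gt0 i; rewrite z.
Qed.

Lemma arm_vertex_onto (v : can_vertex p) : exists i l, (l <= p i)%N /\ v = av i l.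
Proof.
case: v => [[]|[i l]].
- by exists ord0, (p ord0); rewrite arm_vertex_sink.
- by exists ord0, 0.
exists i, l.+1; rewrite arm_vertex_inner; split=> //.
exact: leq_trans (ltn_ord l) (leq_pred _).
Qed.

End CanonicalQuiver.

(** * Paths along the arms *)

Section ArmPaths.
Variables (k : fieldType) (m : nat) (p : 'I_m.+2 -> nat).
Hypothesis p_gt0 : forall i, (0 < p i)%N.
Local Notation Q := (canonical_quiver p).
Local Notation kQ := (path_algebra k Q).
Local Notation av := (arm_vertex p).
Local Notation pe v s := (path_elt k (v : vertex Q) s).

Definition arm_arrow i (l : 'I_(p i)) : arrow Q := Tagged (fun i => 'I_(p i)) l.

Definition arrow_elt i j : kQ :=
  if insub j is Some l then pe (av i j) [:: @arm_arrow i l] else 0.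

(** The idempotent in front provides the trivial path when l = n. *)
Definition segment i l n : kQ := pe (av i l) [::] * \prod_(l <= j < n) arrow_elt i j.

Lemma arrow_eltE i (l : 'I_(p i)) : arrow_elt i l = pe (av i l) [:: arm_arrow l].
Proof. by rewrite /arrow_elt valK. Qed.

Lemma idem_mul (v w : can_vertex p) :
  pe v [::] * pe w [::] = if v == w then pe v [::] else 0.
Proof. by rewrite path_elt_mul. Qed.

Lemma idem_arrow i j : (j < p i)%N -> pe (av i j) [::] * arrow_elt i j = arrow_elt i j.
Proof. by move=> jp; rewrite -[j]/(val (Ordinal jp)) arrow_eltE path_elt_mul eqxx. Qed.

Lemma arrow_idem i j : (j < p i)%N -> arrow_elt i j * pe (av i j.+1) [::] = arrow_elt i j.
Proof.
by move=> jp; rewrite -[j]/(val (Ordinal jp)) arrow_eltE path_elt_mul /walk_end /= eqxx.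
Qed.

Lemma segment_nil i l : segment i l l = pe (av i l) [::].
Proof. by rewrite /segment big_geq ?mulr1. Qed.

Lemma segment_cons i l n : (l < n <= p i)%N ->
  segment i l n = arrow_elt i l * segment i l.+1 n.
Proof.
case/andP=> ln np; rewrite /segment big_ltn // mulrA idem_arrow ?(leq_trans ln) //.
by rewrite mulrA arrow_idem ?(leq_trans ln).
Qed.

Lemma segment_rcons i l n : (l <= n)%N ->
  segment i l n.+1 = segment i l n * arrow_elt i n.
Proof. by move=> ln; rewrite /segment big_nat_recr //= mulrA. Qed.

Lemma segment_idem i l n : (l <= n <= p i)%N ->
  segment i l n * pe (av i n) [::] = segment i l n.
Proof.
case/andP; case: n => [|n] ln np.
  by move: ln; rewrite leqn0 => /eqP->; rewrite segment_nil idem_mul eqxx.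
move: ln; rewrite leq_eqVlt => /predU1P[->|ln].
  by rewrite segment_nil idem_mul eqxx.
by rewrite segment_rcons // -mulrA arrow_idem.
Qed.

Lemma idem_segment i l n : pe (av i l) [::] * segment i l n = segment i l n.
Proof. by rewrite /segment mulrA idem_mul eqxx. Qed.

Lemma walk_segment s i l : (0 < l <= p i)%N -> walk (av i l : vertex Q) s ->
  exists2 n, (l <= n <= p i)%N & pe (av i l) s = segment i l n.
Proof.
elim: s i l => [|[i1 j1] s IHs] i l /andP[l0 lp] /=.
  by move=> _; exists l; rewrite ?leqnn // segment_nil.
case/andP=> /eqP/(arm_vertex_eq p_gt0 (ltnW (ltn_ord j1)) lp)[||]; first 1 last.
- by case=> _ l0'; rewrite l0' in l0.
- by case=> jp; have := ltn_ord j1; rewrite jp ltnn.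
case=> ei el ws; subst i l.
have [|n /andP[ln np] sE] := IHs i1 j1.+1 _ ws; first by rewrite ltn_ord.
exists n; first by rewrite ltnW.
rewrite segment_cons ?ln // arrow_eltE.
by rewrite (path_elt_cons _ (arm_arrow j1)) sE.
Qed.

Lemma path_elt_segment v s : walk (v : vertex Q) s ->
  exists i l n, (l <= n <= p i)%N /\ pe v s = segment i l n.
Proof.
case: s => [|[i j] s] /=.
  move=> _; have [i [l [lp ->]]] := arm_vertex_onto p_gt0 v.
  by exists i, l, l; rewrite leqnn lp segment_nil.
case/andP=> /eqP<- ws.
have [|n /andP[jn np] sE] := @walk_segment s i j.+1 _ ws; first by rewrite ltn_ord.
exists i, j, n; rewrite (ltnW jn) np; split=> //.
by rewrite segment_cons ?jn // arrow_eltE (path_elt_cons _ (arm_arrow j)) sE.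
Qed.

Lemma segment_ind (S : kQ -> Prop) : S 0 ->
    (forall c f g, S f -> S g -> S (c *: f + g)) ->
    (forall i l n, (l <= n <= p i)%N -> S (segment i l n)) -> forall f, S f.
Proof.
move=> S0 SD Ss; apply: path_elt_ind => // v s /path_elt_segment[i [l [n [ln ->]]]].
exact: Ss.
Qed.

(** * The canonical ideal *)

Definition arm_arrows i l : seq (arrow Q) := [seq arm_arrow j | j <- drop l (enum 'I_(p i))].

Lemma arm_arrows_cons i (l : 'I_(p i)) : arm_arrows i l = arm_arrow l :: arm_arrows i l.+1.
Proof.
rewrite /arm_arrows (drop_nth l) ?size_enum_ord //=.
by rewrite nth_ord_enum.
Qed.

Lemma arm_arrows_nil i : arm_arrows i (p i) = [::].
Proof. by rewrite /arm_arrows drop_oversize // size_enum_ord. Qed.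

(** Downward induction on the position along the arm. *)
Lemma arm_arrows_ind i (S : nat -> seq (arrow Q) -> Prop) : S (p i) [::] ->
    (forall (l : 'I_(p i)) s, S l.+1 s -> S l (arm_arrow l :: s)) -> S 0 (arm_arrows i 0).
Proof.
move=> Snil Scons; suff H n : forall l, (l + n = p i)%N -> S l (arm_arrows i l).
  exact: (H (p i)).
elim: n => [|n IHn] l; first by rewrite addn0 => ->; rewrite arm_arrows_nil.
move=> ln; have lp : (l < p i)%N by rewrite -ln addnS ltnS leq_addr.
rewrite -[l]/(val (Ordinal lp)) arm_arrows_cons; apply: Scons; apply: IHn.
by rewrite /= addSnnS.
Qed.

Lemma arm_path_segment i : arm_path k p i = segment i 0 (p i).
Proof.
have -> : arm_path k p i = pe (av i 0) (arm_arrows i 0) by rewrite /arm_arrows drop0.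
apply: (@arm_arrows_ind i (fun l s => pe (av i l) s = segment i l (p i))).
  by rewrite segment_nil.
move=> l s sE; rewrite segment_cons ?ltn_ord ?leqnn // -sE arrow_eltE.
exact: (path_elt_cons _ (arm_arrow l)).
Qed.

Lemma arm_qpath i :
  exists2 r : qpath Q, qstart r = can_source p & qarrows r = arm_arrows i 0.
Proof.
apply: qpath_exists.
  apply: (@arm_arrows_ind i (fun l s => walk (av i l : vertex Q) s)) => // l s ws.
  by rewrite /= eqxx.
rewrite size_map drop0 size_enum_ord -[X in (X <= _)%N]card_ord.
apply: (@leq_card _ _ (fun j : 'I_(p i) => av i j)) => j j'.
move/(arm_vertex_eq p_gt0 (ltnW (ltn_ord j)) (ltnW (ltn_ord j'))).
case=> [[_ e]|[j0 j0']|[jp _]]; first exact: ord_inj.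
  by apply: ord_inj; rewrite j0 j0'.
by have := ltn_ord j; rewrite jp ltnn.
Qed.

Lemma arm_path_coef i j (r : qpath Q) :
    qstart r = can_source p -> qarrows r = arm_arrows j 0 ->
  arm_path k p i r = (i == j)%:R.
Proof.
move=> r1 r2; rewrite ffunE r1 r2 eqxx /=; congr ((nat_of_bool _)%:R).
have -> : [seq Tagged (fun i => 'I_(p i)) j0 : arrow Q | j0 <- enum 'I_(p i)] = arm_arrows i 0.
  by rewrite /arm_arrows drop0.
case: (eqVneq i j) => [->|ne]; first by rewrite eqxx.
apply/negbTE/eqP => e; case/eqP: ne.
have : arm_arrow (Ordinal (p_gt0 i)) \in arm_arrows j 0.
  by rewrite e /arm_arrows drop0; apply: map_f; rewrite mem_enum.
by case/mapP=> l _ /(congr1 tag).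
Qed.

Lemma idem_source_mul (f : kQ) : exists c, f * pe (can_source p) [::] = c *: pe (can_source p) [::].
Proof.
elim/segment_ind: f => [|c f g [cf fE] [cg gE]|i l n /andP[ln np]].
- by exists 0; rewrite mul0r scale0r.
- by exists (c * cf + cg); rewrite mulrDl -scalerAl fE gE scalerA scalerDl.
rewrite -(@segment_idem i l n) ?ln // -mulrA idem_mul arm_vertex_eq_source //.
case: eqP ln => [-> |_] ln; last by exists 0; rewrite mulr0 scale0r.
move: ln; rewrite leqn0 => /eqP->; exists 1.
by rewrite segment_nil idem_mul eqxx scale1r.
Qed.

Lemma idem_sink_mul (f : kQ) : exists c, pe (can_sink p) [::] * f = c *: pe (can_sink p) [::].
Proof.
elim/segment_ind: f => [|c f g [cf fE] [cg gE]|i l n /andP[ln np]].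
- by exists 0; rewrite mulr0 scale0r.
- by exists (c * cf + cg); rewrite mulrDr -scalerAr fE gE scalerA scalerDl.
rewrite -idem_segment mulrA idem_mul eq_sym arm_vertex_eq_sink ?(leq_trans ln) //.
case: eqP ln => [-> |_] ln; last by exists 0; rewrite mul0r scale0r.
have -> : n = p i by apply/eqP; rewrite eqn_leq np ln.
by exists 1; rewrite segment_nil idem_mul arm_vertex_sink // eqxx scale1r.
Qed.

Variable lam : 'I_m -> k.
Local Notation rel := (canonical_relation p lam).

Lemma relation_ends i :
  pe (can_source p) [::] * rel i * pe (can_sink p) [::] = rel i.
Proof.
have ends j : pe (can_source p) [::] * arm_path k p j * pe (can_sink p) [::] = arm_path k p j.
  rewrite arm_path_segment (idem_segment j 0) -(arm_vertex_sink p_gt0 (leqnn (p j))).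
  by rewrite segment_idem ?leqnn.
rewrite /canonical_relation mulrBr mulrDr mulrBl mulrDl -scalerAr -scalerAl.
by rewrite !ends.
Qed.

(** The relations go from the source, where no nontrivial path ends, to the sink,
    where none starts. So their linear span already is an ideal. *)
Lemma canonical_ideal_span : (canonical_ideal p lam <= <<codom rel>>)%VS.
Proof.
have genP (W : {vspace kQ}) : (forall i, rel i \in W) -> (<<codom rel>> <= W)%VS.
  by move=> h; apply/span_subvP=> _ /codomP[i ->].
have mulS f x : x \in <<codom rel>>%VS -> f * x \in <<codom rel>>%VS.
  rewrite -(amullE f) memv_preim; move: x; apply/subvP/genP => i.
  rewrite -memv_preim amullE -relation_ends !mulrA.
  have [c ->] := idem_source_mul f; rewrite -!scalerAl relation_ends.
  by rewrite memvZ // memv_span // codom_f.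
have mulSr f x : x \in <<codom rel>>%VS -> x * f \in <<codom rel>>%VS.
  have amulrE y : amulr f y = y * f by rewrite lfunE.
  rewrite -amulrE memv_preim; move: x; apply/subvP/genP => i.
  rewrite -memv_preim amulrE -relation_ends -(mulrA _ _ f).
  have [c ->] := idem_sink_mul f; rewrite -scalerAr relation_ends.
  by rewrite memvZ // memv_span // codom_f.
apply/prodvP=> f g fI _; apply: mulSr; move: f fI; apply/subvP.
by apply/prodvP=> f x _; apply: mulS.
Qed.

Lemma relation_in_ideal i : rel i \in canonical_ideal p lam.
Proof.
rewrite -[rel i]mulr1 -[rel i]mul1r /canonical_ideal.
by rewrite !memv_mul ?memvf // memv_span // codom_f.
Qed.

(** The arm i + 2 occurs in the relation i and in no other one, so that no nonzero
    combination of the relations involves the first two arms only. *)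
Lemma arm_paths_independent c0 c1 :
    c0 *: arm_path k p ord0 + c1 *: arm_path k p (lift ord0 ord0)
      \in canonical_ideal p lam ->
  c0 = 0 /\ c1 = 0.
Proof.
move=> /(subvP canonical_ideal_span) fS.
have /memv_sumP[u uL fE] :
    c0 *: arm_path k p ord0 + c1 *: arm_path k p (lift ord0 ord0)
      \in (\sum_i <[rel i]>)%VS.
  move: fS; apply/subvP/span_subvP=> _ /codomP[i ->].
  by rewrite memvE (sumv_sup i).
have coef j : exists r, forall i, arm_path k p i r = (i == j)%:R.
  have [r r1 r2] := arm_qpath j; exists r => i; exact: arm_path_coef.
have eqF i : (ord0 == rshift 2 i :> 'I_m.+2) = false /\
    (lift ord0 ord0 == rshift 2 i :> 'I_m.+2) = false by [].
have u0 i : u i = 0.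
  have [r rE] := coef (rshift 2 i).
  have frE : (c0 *: arm_path k p ord0 + c1 *: arm_path k p (lift ord0 ord0)) r =
      (\sum_i u i) r.
    by rewrite fE.
  have [F0 F1] := eqF i.
  have uE l : u l r = 0 \/ l = i.
    case: (eqVneq l i) => [->|li]; [by right|left].
    have /vlineP[d ->] := uL l isT.
    rewrite !pa_coefE !rE F0 F1 (inj_eq (@rshift_inj 2 m)) (negPf li).
    by rewrite mulr0 addr0 subr0 mulr0.
  rewrite pa_coef_sum !pa_coefE !rE F0 F1 !mulr0 addr0 (bigD1 i) // big1 in frE; last first.
    by move=> l /= li; case: (uE l) => // e; rewrite e eqxx in li.
  have /vlineP[d udE] := uL i isT; rewrite udE.
  move/esym: frE; rewrite Monoid.mulm1 udE !pa_coefE !rE F0 F1 eqxx mulr0 addr0 oppr0 addr0.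
  by rewrite mulr1 => ->; rewrite scale0r.
have f0 : c0 *: arm_path k p ord0 + c1 *: arm_path k p (lift ord0 ord0) = 0.
  by rewrite fE big1.
have [r0 r0E] := coef ord0; have [r1 r1E] := coef (lift ord0 ord0).
split.
  have : (c0 *: arm_path k p ord0 + c1 *: arm_path k p (lift ord0 ord0)) r0 = (0 : kQ) r0.
    by rewrite f0.
  rewrite !pa_coefE !r0E.
  by rewrite mulr1 mulr0 addr0.
have : (c0 *: arm_path k p ord0 + c1 *: arm_path k p (lift ord0 ord0)) r1 = (0 : kQ) r1.
  by rewrite f0.
 rewrite !pa_coefE !r1E.
by rewrite mulr1 mulr0 add0r.
Qed.

End ArmPaths.

(** * The canonical algebra *)

Section CanonicalAlgebra.
Variables (k : fieldType) (m : nat) (p : 'I_m.+2 -> nat).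
Hypothesis p_gt0 : forall i, (0 < p i)%N.
Variable lam : 'I_m -> k.
Hypotheses (lam_neq0 : forall i, lam i != 0) (lam_inj : injective lam).
Variables (A : falgType k) (pi : {lrmorphism path_algebra k (canonical_quiver p) -> A}).
Hypothesis A_canonical : is_canonical_algebra lam pi.
Local Notation av := (arm_vertex p).
Local Notation E := (vertex_idem pi).
Local Notation source := (can_source p).
Local Notation sink := (can_sink p).

Definition arr i j : A := pi (arrow_elt k p i j).
Definition seg i l n : A := pi (segment k p i l n).
Definition arm i : A := seg i 0 (p i).

Lemma alg_ind (S : A -> Prop) : S 0 ->
    (forall c a b, S a -> S b -> S (c *: a + b)) ->
    (forall i l n, (l <= n <= p i)%N -> S (seg i l n)) -> forall a, S a.
Proof.
move=> S0 SD Ss a; have [f <-] := A_canonical.1 a.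
apply: (segment_ind p_gt0 (S := fun f => S (pi f))) => [|c g h Sg Sh|i l n /Ss //].
- by rewrite raddf0.
- by rewrite linearP; apply: SD.
Qed.

Lemma E_mul v w : E v * E w = if v == w then E v else 0.
Proof. by rewrite -rmorphM idem_mul; case: eqP => // _; rewrite raddf0. Qed.

Lemma E_sq v : E v * E v = E v. Proof. by rewrite E_mul eqxx. Qed.

Lemma E_sum : \sum_v E v = 1.
Proof. by rewrite -(rmorph1 pi) -sum_path_elt_nil raddf_sum. Qed.

Lemma idem_arr i j : (j < p i)%N -> E (av i j) * arr i j = arr i j.
Proof. by move=> jp; rewrite -rmorphM idem_arrow. Qed.

Lemma arr_idem i j : (j < p i)%N -> arr i j * E (av i j.+1) = arr i j.
Proof. by move=> jp; rewrite -rmorphM arrow_idem. Qed.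

Lemma seg_nil i l : seg i l l = E (av i l).
Proof. by rewrite /seg segment_nil. Qed.

Lemma seg_cons i l n : (l < n <= p i)%N -> seg i l n = arr i l * seg i l.+1 n.
Proof. by move=> ln; rewrite -rmorphM -segment_cons. Qed.

Lemma seg_rcons i l n : (l <= n)%N -> seg i l n.+1 = seg i l n * arr i n.
Proof. by move=> ln; rewrite -rmorphM -segment_rcons. Qed.

Lemma idem_seg i l n v : E v * seg i l n = if v == av i l then seg i l n else 0.
Proof.
have e : E (av i l) * seg i l n = seg i l n by rewrite -rmorphM idem_segment.
by rewrite -e mulrA E_mul; case: eqP => [->|_]; rewrite ?e ?mul0r.
Qed.

Lemma seg_idem i l n v : (l <= n <= p i)%N ->
  seg i l n * E v = if v == av i n then seg i l n else 0.
Proof.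
move=> ln; have e : seg i l n * E (av i n) = seg i l n by rewrite -rmorphM segment_idem.
by rewrite -e -mulrA E_mul eq_sym; case: eqP => _; rewrite ?e ?mulr0.
Qed.

Lemma seg_cat i l n q : (l <= n)%N -> (n <= q)%N -> (q <= p i)%N ->
  seg i l n * seg i n q = seg i l q.
Proof.
move=> ln; elim: q => [|q IHq] nq qp.
  by move: nq; rewrite leqn0 => /eqP n0; rewrite n0 seg_nil seg_idem ?eqxx // -n0 ln n0.
move: nq; rewrite leq_eqVlt => /predU1P[e|nq].
  by rewrite -e seg_nil seg_idem ?eqxx // ln e qp.
by rewrite !seg_rcons ?(leq_trans ln) // mulrA IHq // ltnW.
Qed.

Lemma mul_E_source a : exists c, a * E source = c *: E source.
Proof.
have [f <-] := A_canonical.1 a; have [c e] := idem_source_mul p_gt0 f.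
by exists c; rewrite -rmorphM e; apply: linearZ.
Qed.

Lemma E_sink_mul a : exists c, E sink * a = c *: E sink.
Proof.
have [f <-] := A_canonical.1 a; have [c e] := idem_sink_mul p_gt0 f.
by exists c; rewrite -rmorphM e; apply: linearZ.
Qed.

(** * Linear dependence between the paths along the arms *)

Lemma arm01_independent c0 c1 :
  c0 *: arm ord0 + c1 *: arm (lift ord0 ord0) = 0 -> c0 = 0 /\ c1 = 0.
Proof.
move=> e; apply: (arm_paths_independent p_gt0 (lam := lam)); apply/A_canonical.2.
by rewrite !arm_path_segment // raddfD /= !linearZ.
Qed.

(** The coordinates of arm i with respect to the first two arms. *)
Definition arm_coef (i : 'I_m.+2) : k * k :=
  match split (i : 'I_(2 + m)) with
  | inl j => if j == 0 then (1, 0) else (0, 1)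
  | inr j => (1, lam j)
  end.

Lemma arm_indexP (i : 'I_m.+2) :
  [\/ i = ord0, i = lift ord0 ord0 | exists j, i = rshift 2 j].
Proof.
case: (splitP (i : 'I_(2 + m))) => j ij; last by constructor 3; exists j; apply: val_inj.
by case: j ij => [[|[|j]] //= _] ij; [constructor 1|constructor 2]; apply: val_inj.
Qed.

Lemma arm_coef0 : arm_coef ord0 = (1, 0).
Proof.
by rewrite /arm_coef; case: splitP => j // ij; rewrite (_ : j == 0) //; apply/eqP/val_inj.
Qed.

Lemma arm_coef1 : arm_coef (lift ord0 ord0) = (0, 1).
Proof.
rewrite /arm_coef; case: splitP => j // ij; rewrite (_ : j == 0 = false) //.
by apply/eqP => j0; rewrite j0 in ij.
Qed.

Lemma arm_coefS j : arm_coef (rshift 2 j) = (1, lam j).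
Proof.
rewrite /arm_coef; case: splitP => l lj; first by have := ltn_ord l; rewrite -lj.
by congr (_, lam _); apply: val_inj; apply: (@addnI 2); rewrite -lj.
Qed.

Lemma arm_lin i : arm i = (arm_coef i).1 *: arm ord0 + (arm_coef i).2 *: arm (lift ord0 ord0).
Proof.
case: (arm_indexP i) => [->|->|[j ->]].
- by rewrite arm_coef0 scale1r scale0r addr0.
- by rewrite arm_coef1 scale0r scale1r add0r.
rewrite arm_coefS scale1r; apply/eqP; rewrite -subr_eq0; apply/eqP.
have /A_canonical.2 := relation_in_ideal p lam j.
by rewrite /canonical_relation !arm_path_segment // raddfB /= raddfD /= linearZ.
Qed.

(** The points of the projective line that belong to the arms are pairwise
    distinct. *)
Lemma arm_coef_det i j : i != j ->
  (arm_coef i).1 * (arm_coef j).2 - (arm_coef j).1 * (arm_coef i).2 != 0.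
Proof.
case: (arm_indexP i) => [->|->|[i' ->]]; case: (arm_indexP j) => [->|->|[j' ->]];
  rewrite ?eqxx ?arm_coef0 ?arm_coef1 ?arm_coefS //=
    ?mul0r ?mulr0 ?mul1r ?mulr1 ?subr0 ?sub0r ?oppr_eq0 ?oner_eq0 ?lam_neq0 //.
rewrite subr_eq0 => ij; apply: contra_neq ij => /lam_inj e.
by rewrite e.
Qed.

(** By Cramer's rule. *)
Lemma arm_span i j : i != j -> forall l, exists c d, arm l = c *: arm i + d *: arm j.
Proof.
move=> /arm_coef_det; rewrite [arm i]arm_lin [arm j]arm_lin => D l.
rewrite [arm l]arm_lin.
move: (arm_coef i) (arm_coef j) (arm_coef l) D => [a b] [a' b'] [e f] /= D.
exists ((e * b' - f * a') / (a * b' - a' * b)), ((f * a - e * b) / (a * b' - a' * b)).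
rewrite !scalerDr !scalerA addrACA -!scalerDl; congr (_ *: _ + _ *: _).
  by field.
by field.
Qed.

Lemma arm_neq0 i : arm i != 0.
Proof.
apply/eqP; rewrite arm_lin => /arm01_independent.
case: (arm_indexP i) => [->|->|[j ->]];
  by rewrite ?arm_coef0 ?arm_coef1 ?arm_coefS //= => -[/eqP + /eqP]; rewrite oner_eq0.
Qed.

Lemma seg_neq0 i l n : (l <= n <= p i)%N -> seg i l n != 0.
Proof.
case/andP=> ln np; apply: contra_neq (arm_neq0 i) => s0.
rewrite /arm -(@seg_cat i 0 l (p i)) ?(leq_trans ln) //.
by rewrite -(@seg_cat i l n (p i)) // s0 mul0r mulr0.
Qed.

(** * The spaces of paths between two vertices *)

Lemma inner_eq i l i' l' : (0 < l < p i)%N -> (l' <= p i')%N ->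
  (av i' l' == av i l) = (i' == i) && (l' == l).
Proof.
case/andP=> l0 lp lp'; apply/eqP/andP => [/(arm_vertex_eq p_gt0 lp' (ltnW lp))|[/eqP-> /eqP-> //]].
case=> [[-> ->]|[_ z]|[_ z]]; rewrite ?eqxx // in l0 lp *.
  by rewrite z in l0.
by rewrite z ltnn in lp.
Qed.

Lemma source_inner j l a : (0 < l < p j)%N ->
  exists c, E source * a * E (av j l) = c *: seg j 0 l.
Proof.
move=> lp; elim/alg_ind: a => [|c a b [ca aE] [cb bE]|i q n qn].
- by exists 0; rewrite mulr0 mul0r scale0r.
- exists (c * ca + cb); rewrite mulrDr mulrDl -scalerAr -scalerAl aE bE.
  by rewrite scalerDl scalerA.
have [qn' np] := andP qn.
rewrite idem_seg eq_sym arm_vertex_eq_source ?(leq_trans qn') //.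
case: eqP => [q0|_]; last by exists 0; rewrite mul0r scale0r.
rewrite seg_idem // eq_sym inner_eq //; case: andP => [[/eqP-> /eqP->]|_].
  by exists 1; rewrite q0 scale1r.
by exists 0; rewrite scale0r.
Qed.

Lemma source_sink a :
  exists c d, E source * a * E sink = c *: arm ord0 + d *: arm (lift ord0 ord0).
Proof.
elim/alg_ind: a => [|c a b [ca [da aE]] [cb [db bE]]|i q n qn].
- by exists 0, 0; rewrite mulr0 mul0r !scale0r addr0.
- exists (c * ca + cb), (c * da + db).
  rewrite mulrDr mulrDl -scalerAr -scalerAl aE bE.
  by rewrite scalerDr !scalerA !scalerDl addrACA.
have [qn' np] := andP qn.
rewrite idem_seg eq_sym arm_vertex_eq_source ?(leq_trans qn') //.
case: eqP => [q0|_]; last by exists 0, 0; rewrite mul0r !scale0r addr0.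
rewrite seg_idem // eq_sym arm_vertex_eq_sink //; case: eqP => [->|_].
  by rewrite q0 -/(arm i) arm_lin; eexists; eexists.
by exists 0, 0; rewrite !scale0r addr0.
Qed.

Lemma inner_start i j a : (0 < j < p i)%N ->
  exists c a', E (av i j) * a = c *: E (av i j) + arr i j * (E (av i j.+1) * a').
Proof.
move=> jp; have [j0 jp'] := andP jp.
elim/alg_ind: a => [|c a b [ca [a' aE]] [cb [b' bE]]|i' q n qn].
- by exists 0, 0; rewrite !mulr0 scale0r addr0.
- exists (c * ca + cb), (c *: a' + b').
  rewrite mulrDr -scalerAr aE bE scalerDr scalerDl scalerA addrACA.
  by rewrite !mulrDr -!scalerAr.
have [qn' np] := andP qn.
rewrite idem_seg eq_sym inner_eq ?(leq_trans qn') //.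
case: andP => [[/eqP ei /eqP eq]|_]; last first.
  by exists 0, 0; rewrite !mulr0 scale0r addr0.
subst i' q; move: qn'; rewrite leq_eqVlt => /predU1P[<-|jn].
  by exists 1, 0; rewrite seg_nil !mulr0 scale1r addr0.
exists 0, (seg i j.+1 n).
by rewrite scale0r add0r mulrA arr_idem // -seg_cons ?jn.
Qed.

(** The quiver has no oriented cycle. *)
Lemma no_return i j a : (0 < j < p i)%N -> E (av i j.+1) * a * E (av i j) = 0.
Proof.
move=> jp; have [j0 jp'] := andP jp.
elim/alg_ind: a => [|c a b aE bE|i' q n qn].
- by rewrite mulr0 mul0r.
- by rewrite mulrDr mulrDl -scalerAr -scalerAl aE bE scaler0 addr0.
have [qn' np] := andP qn.
rewrite idem_seg; case: eqP => [e|_]; last by rewrite mul0r.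
rewrite seg_idem // eq_sym inner_eq //; case: andP => // -[/eqP ei /eqP en].
subst i' n; case: (arm_vertex_eq p_gt0 jp' (leq_trans qn' np) e).
- by case=> _ e'; rewrite -e' ltnn in qn'.
- by case.
by case=> _ e'; rewrite e' in qn'; have := leq_trans jp' qn'; rewrite ltnn.
Qed.

Lemma right_ideal_segments i j a : (j < p i)%N ->
  exists c : nat -> k, E (av i j.+1) * a =
    \sum_(j.+1 <= l < (p i).+1) c l *: seg i j.+1 l.
Proof.
move=> jp; elim/alg_ind: a => [|x a b [ca aE] [cb bE]|i' q n qn].
- by exists (fun=> 0); rewrite mulr0 big1 // => l _; rewrite scale0r.
- exists (fun l => x * ca l + cb l); rewrite mulrDr -scalerAr aE bE.
  rewrite scaler_sumr -big_split; apply: eq_bigr => l _.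
  by rewrite scalerDl scalerA.
have [qn' np] := andP qn; rewrite idem_seg; case: eqP => [e|_]; last first.
  by exists (fun=> 0); rewrite big1 // => l _; rewrite scale0r.
suff [n0 n0P ->] : exists2 n0, (j < n0 < (p i).+1)%N & seg i' q n = seg i j.+1 n0.
  exists (fun l => (l == n0)%:R).
  rewrite (bigD1_seq n0) ?iota_uniq ?mem_index_iota //= eqxx scale1r big1 ?addr0 //.
  by move=> l /negPf->; rewrite scale0r.
have [[ei eq]|[//]|[eq1 eq2]] := arm_vertex_eq p_gt0 jp (leq_trans qn' np) e.
  by subst i' q; exists n => //; rewrite qn'.
have -> : n = q by apply/eqP; rewrite eqn_leq qn' eq2 np.
by exists j.+1; rewrite ?ltnS ?leqnn // !seg_nil e.
Qed.

(** The segments that start at the target of the arrow are extended to segments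
    with distinct ends, none of which is zero. *)
Lemma arr_mul_inj i j a : (j < p i)%N ->
  E (av i j.+1) * a = a -> arr i j * a = 0 -> a = 0.
Proof.
move=> jp aK; rewrite -aK; have [c ->] := right_ideal_segments a jp => e.
rewrite big_nat big1 // => l lp.
suff -> : c l = 0 by rewrite scale0r.
have l1 : (j <= l <= p i)%N by case/andP: lp => jl lp; rewrite ltnW.
have := congr1 (fun y => y * E (av i l)) e; rewrite /= mul0r mulr_sumr mulr_suml.
rewrite (bigD1_seq l) ?iota_uniq ?mem_index_iota //= big_nat_cond big1 => [|n].
  rewrite -scalerAr -scalerAl -seg_cons // seg_idem // eqxx Monoid.mulm1.
  by move=> /eqP; rewrite scaler_eq0 (negPf (seg_neq0 _)) // orbF => /eqP.
case/andP=> /andP[jn np] nl.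
rewrite -scalerAr -scalerAl -seg_cons ?jn // seg_idem; last by rewrite (ltnW jn).
case: eqP => [av_eq|_]; last by rewrite scaler0.
case/andP: l1 => jl lp'.
have [[_ ln]|[l0 _]|[lp'' np']] := arm_vertex_eq p_gt0 lp' np av_eq.
- by rewrite ln eqxx in nl.
- by rewrite l0 in lp.
by rewrite lp'' np' eqxx in nl.
Qed.

(** * The Euler form of the dimension vector 1 *)

Lemma arm_ord0_inj a : E sink * a = a -> arm ord0 * a = 0 -> a = 0.
Proof.
move=> <-; have [c ->] := E_sink_mul a.
rewrite -scalerAr seg_idem ?leqnn // -(arm_vertex_sink p_gt0 (leqnn (p ord0))) eqxx.
by move=> /eqP; rewrite scaler_eq0 (negPf (arm_neq0 _)) orbF => /eqP->; rewrite scale0r.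
Qed.

Lemma idem_arm i : E source * arm i = arm i.
Proof. by rewrite idem_seg eqxx. Qed.

Lemma arm_idem i : arm i * E sink = arm i.
Proof. by rewrite seg_idem ?leqnn // arm_vertex_sink // eqxx. Qed.

Definition euler_module : rmodule A := cokmod (E source) (arm ord0).

Local Notation Usub := (coker_sub (E source) (arm ord0)).

Lemma euler_module_mem a : a \in Usub <-> exists c, E source * a = c *: arm ord0.
Proof.
split=> [/mem_coker_space[b ->]|[c e]].
  rewrite -(arm_idem ord0) -mulrA; have [c ->] := E_sink_mul b.
  by exists c; rewrite -scalerAr.
by apply/mem_coker_space; exists (c%:A); rewrite e mulr_algr.
Qed.

(** The class of s spans the component of the cokernel at v. *)
Lemma euler_module_line v s : E source * s * E v = s -> s \notin Usub ->
    (forall a, exists c d, E source * a * E v = c *: s + d *: arm ord0) ->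
  \dim (limg (ract euler_module (E v))) = 1%N.
Proof.
move=> sK sU span; have sE : s * E v = s by rewrite -{1}sK -mulrA E_sq sK.
have -> : limg (ract euler_module (E v)) = <[quo_map Usub s]>%VS.
  apply/eqP; rewrite eqEsubv; apply/andP; split; apply/subvP=> y.
    case/memv_imgP=> z _ ->; rewrite -[z]quo_mapK -quo_map_hom regmodE.
    have [c [d e]] := span (vsval z); apply/vlineP; exists c.
    apply/eqP; rewrite -lfunZ quo_map_eq; apply/euler_module_mem; exists d.
    rewrite mulrBr mulrA e -scalerAr -{2}sK !mulrA E_sq sK.
    by rewrite addrC addKr.
  case/vlineP=> c ->; apply/memvZ/memv_imgP.
  exists (quo_map Usub s); rewrite ?memvf // -quo_map_hom regmodE.
  by rewrite sE.
by rewrite dim_vline quo_map_eq0 sU.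
Qed.

Lemma euler_module_dim : dim_vector E euler_module = ones p.
Proof.
apply/ffunP=> v; rewrite !ffunE; have [i [l [lp ->]]] := arm_vertex_onto p_gt0 v.
have [->|->|l_in] := arm_positionP lp.
- apply: (@euler_module_line _ (E source)).
  + by rewrite !E_sq.
  + apply/negP=> /euler_module_mem[c]; rewrite E_sq => e.
    have := congr1 (fun a => a * E source) e; rewrite /= E_sq -scalerAl.
    rewrite seg_idem ?leqnn // arm_vertex_sink //= scaler0 => /eqP.
    by rewrite -[E source]/(E (av ord0 0)) -seg_nil (negPf (seg_neq0 _)) ?leqnn.
  move=> a; have [c e] := mul_E_source a; exists c, 0.
  by rewrite -mulrA e -scalerAr E_sq scale0r addr0.
- rewrite arm_vertex_sink //; apply: (@euler_module_line _ (arm (lift ord0 ord0))).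
  + by rewrite idem_arm arm_idem.
  + apply/negP=> /euler_module_mem[c]; rewrite idem_arm => /eqP.
    rewrite -subr_eq0 addrC -scaleNr -[X in _ + X]scale1r => /eqP/arm01_independent[_].
    by move/eqP; rewrite oner_eq0.
  by move=> a; have [c [d ->]] := source_sink a; exists d, c; rewrite addrC.
apply: (@euler_module_line _ (seg i 0 l)).
- by rewrite idem_seg eqxx seg_idem ?eqxx.
- apply/negP=> /euler_module_mem[c]; rewrite idem_seg eqxx => e.
  have := congr1 (fun a => a * E (av i l)) e; rewrite /= seg_idem // eqxx -scalerAl.
  rewrite seg_idem ?leqnn // (arm_vertex_sink p_gt0 (leqnn (p ord0))).
  rewrite arm_vertex_eq_sink // eqn_leq lp leqNgt; case/andP: l_in => _ ->.
  by rewrite scaler0 => /eqP; rewrite (negPf (seg_neq0 _)).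
by move=> a; have [c ->] := source_inner a l_in; exists c, 0; rewrite scale0r addr0.
Qed.

Lemma euler_form_ones (N : rmodule A) :
  euler_form_dim E (ones p) N
    ((\dim (limg (ract N (E source))))%:Z - (\dim (limg (ract N (E sink))))%:Z).
Proof.
exists euler_module; first exact: euler_module_dim.
apply: euler_form_cokmod; rewrite ?E_sq ?idem_arm ?arm_idem //.
exact: arm_ord0_inj.
Qed.

(** * Modules of dimension vector 1 *)

Section OnesModule.
Variable M : rmodule A.
Hypothesis M_ones : dim_vector E M = ones p.

Definition gen (v : can_vertex p) : M := vpick (limg (ract M (E v))).

Lemma act_idemE (y : M) v : y |> E v \in <[gen v]>%VS.
Proof.
have d1 : \dim (limg (ract M (E v))) = 1%N.
  by have /ffunP/(_ v) := M_ones; rewrite !ffunE.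
have g0 : gen v != 0 by rewrite vpick0 -dimv_eq0 d1.
suff -> : <[gen v]>%VS = limg (ract M (E v)) by rewrite memv_img ?memvf.
by apply/eqP; rewrite eqEdim d1 dim_vline g0 -memvE memv_pick.
Qed.

Lemma gen_neq0 v : gen v != 0.
Proof.
rewrite vpick0 -dimv_eq0.
by have /ffunP/(_ v) := M_ones; rewrite !ffunE => ->.
Qed.

Lemma gen_idem v w : gen v |> E w = if v == w then gen v else 0.
Proof.
have /memv_imgP[y _ e] := memv_pick (limg (ract M (E v))).
by rewrite /gen e -ractMr E_mul; case: eqP => // _; rewrite ract0r.
Qed.

Lemma act_idem (y : M) v : exists c, y |> E v = c *: gen v.
Proof. exact/vlineP/act_idemE. Qed.

Lemma act_sum (y : M) : y = \sum_v y |> E v.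
Proof. by rewrite -ract_sumr E_sum ract1r. Qed.

(** Every submodule of M has this form, since M is a line at each vertex. *)
Definition vanish (W : pred (can_vertex p)) : {vspace M} :=
  lker (ract M (\sum_(v | W v) E v)).

Lemma vanishP (W : pred (can_vertex p)) (y : M) :
  reflect (forall v, W v -> y |> E v = 0) (y \in vanish W).
Proof.
rewrite memv_ker ract_sumr; apply: (iffP eqP) => [e v Wv|e].
  have := congr1 (fun z => z |> E v) e; rewrite /= lfun0 linear_sum (bigD1 v) //=.
  rewrite -ractMr E_sq big1 ?addr0 // => w /andP[_ wv].
  by rewrite -ractMr E_mul (negPf wv) ract0r.
by rewrite big1.
Qed.

Definition vanish_stable (W : pred (can_vertex p)) : Prop :=
  forall i l n, (l <= n <= p i)%N -> W (av i n) -> ~~ W (av i l) -> ract M (seg i l n) = 0.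

Lemma vanish_act (W : pred (can_vertex p)) : vanish_stable W ->
  forall a (y : M), y \in vanish W -> y |> a \in vanish W.
Proof.
move=> Wst a y /vanishP yW; elim/alg_ind: a => [|c a b ya yb|i l n ln].
- by rewrite ract0r mem0v.
- by rewrite ractDr ractZr memvD ?memvZ.
apply/vanishP=> v Wv; rewrite -ractMr seg_idem //.
case: eqP => [ev|_]; last by rewrite ract0r.
case: (boolP (W (av i l))) => Wl; last first.
  by rewrite Wst ?zero_lfunE // -ev.
have := idem_seg i l n (av i l); rewrite eqxx => <-.
by rewrite ractMr yW // lfun0.
Qed.

Definition vanish_sub W (Wst : vanish_stable W) : submodule M :=
  Submodule (vanish_act Wst).

Lemma vanish_gen W v : (gen v \in vanish W) = ~~ W v.
Proof.
apply/vanishP/idP => [h|nW w Ww]; last first.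
  by rewrite gen_idem; case: eqP Ww nW => // <- ->.
by apply/negP=> /h; rewrite gen_idem eqxx; apply/eqP/gen_neq0.
Qed.

(** * Vanishing of arrows on Serre stable modules *)

Section SerreStable.
Hypothesis M_stable : serre_stable M.

(** The quotient of M by vanish W is supported on W. It is identified with a
    cokernel as soon as it is generated at the vertex v. *)
Lemma serre_stable_arrow W (Wst : vanish_stable W) v (b e' : A) :
    e' * e' = e' -> E v * b = b -> b * e' = b ->
    (forall a, e' * a = a -> b * a = 0 -> a = 0) ->
    W v -> gen v |> b \in vanish W ->
    (forall u, W u -> exists a, gen u = gen v |> a) ->
    (forall a, E v * a = a -> gen v |> a \in vanish W -> exists a', a = b * a') ->
  limg (ract M b) <> limg (ract M e').
Proof.
move=> e'e' vb be' b_inj Wv bW reach xker.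
apply: (@serre_stable_coker _ _ _ (E v) _ _ (vanish_sub Wst) (gen v)) => //.
- exact: E_sq.
- by rewrite gen_idem eqxx.
- by rewrite /= vanish_gen Wv.
move=> y; rewrite [y]act_sum.
elim/big_rec: _ => [|u z _ [a za]]; first by exists 0; rewrite ract0r subr0 mem0v.
suff [a' ya'] : exists a', y |> E u - gen v |> a' \in vanish W.
  by exists (a' + a); rewrite ractDr opprD addrACA memvD.
have [c ->] := act_idem y u; case: (boolP (W u)) => Wu.
  have [a' ->] := reach _ Wu.
  by exists (c *: a'); rewrite ractZr subrr mem0v.
by exists 0; rewrite ract0r subr0 memvZ // vanish_gen.
Qed.

Local Notation zero_arrow i j := (ract M (arr i j) == 0).

Lemma arr_zero i j : (j < p i)%N -> limg (ract M (arr i j)) <> limg (ract M (E (av i j.+1))) ->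
  zero_arrow i j.
Proof.
move=> jp ne.
have sub : (limg (ract M (arr i j)) <= limg (ract M (E (av i j.+1))))%VS.
  by apply/subvP=> _ /memv_imgP[y _ ->]; rewrite -(arr_idem jp) ractMr memv_img ?memvf.
have d1 : \dim (limg (ract M (E (av i j.+1)))) = 1%N.
  by have /ffunP/(_ (av i j.+1)) := M_ones; rewrite !ffunE.
have d0 : limg (ract M (arr i j)) = 0%VS.
  apply/eqP; rewrite -dimv_eq0; case: posnP => // d_gt0; case: ne.
  by apply/eqP; rewrite eqEdim sub d1.
apply/eqP/lfunP=> y; rewrite zero_lfunE; apply/eqP; rewrite -memv0 -d0.
by rewrite memv_img ?memvf.
Qed.

Lemma zero_arrow_seg i j l n : (l <= j < n)%N -> (n <= p i)%N ->
  zero_arrow i j -> ract M (seg i l n) = 0.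
Proof.
case/andP=> lj jn np /eqP z; apply/lfunP=> y; rewrite zero_lfunE.
have -> : seg i l n = seg i l j * (arr i j * seg i j.+1 n).
  by rewrite -seg_cons ?jn // seg_cat // ltnW.
by rewrite !ractMr z zero_lfunE lfun0.
Qed.

Lemma act_arrow i j : (j < p i)%N -> ~~ zero_arrow i j ->
  exists2 c, c != 0 & gen (av i j) |> arr i j = c *: gen (av i j.+1).
Proof.
move=> jp nz; have [c e] := act_idem (gen (av i j) |> arr i j) (av i j.+1).
rewrite -ractMr arr_idem // in e; exists c => //.
apply: contra_neq nz => c0; apply/lfunP=> y; rewrite zero_lfunE.
rewrite -(idem_arr jp) ractMr; have [d ->] := act_idem y (av i j).
by rewrite lfunZ e c0 scale0r scaler0.
Qed.

Lemma act_segment i l n : (l <= n <= p i)%N ->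
    (forall j, (l <= j < n)%N -> ~~ zero_arrow i j) ->
  exists2 c, c != 0 & gen (av i l) |> seg i l n = c *: gen (av i n).
Proof.
case/andP; elim: n => [|n IHn] ln np nz.
  move: ln; rewrite leqn0 => /eqP->; exists 1; rewrite ?oner_eq0 //.
  by rewrite seg_nil gen_idem eqxx scale1r.
move: ln; rewrite leq_eqVlt => /predU1P[->|ln].
  by exists 1; rewrite ?oner_eq0 // seg_nil gen_idem eqxx scale1r.
have [|c c0 e] := IHn ln (ltnW np).
  by move=> j /andP[lj jn]; rewrite nz // lj ltnW.
have [|d d0 e'] := act_arrow np; first by apply: nz; rewrite ltnSn andbT -ltnS.
exists (c * d); first by rewrite mulf_neq0.
by rewrite seg_rcons // ractMr e lfunZ e' scalerA.
Qed.

(** If all arrows into a vertex act by zero, then M maps onto the simple module at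
    this vertex. *)
Lemma pred1_stable i l : (0 < l <= p i)%N ->
    (forall i' n, (n < p i')%N -> av i' n.+1 = av i l -> zero_arrow i' n) ->
  vanish_stable (pred1 (av i l)).
Proof.
move=> lp z i' l' n /andP[ln np] /= /eqP e; rewrite eq_sym => ne.
case: n ln np e => [|n] ln np e.
  by move: ln ne; rewrite leqn0 => /eqP->; rewrite e eqxx.
move: ln; rewrite leq_eqVlt => /predU1P[l'e|ln]; first by rewrite l'e e eqxx in ne.
by apply: (@zero_arrow_seg _ n); rewrite ?ltnS ?leqnn ?andbT // z.
Qed.

(** The simple module at an inner vertex is the cokernel of the arrow out of it. *)
Lemma zero_arrow_next i j : (j.+1 < p i)%N -> zero_arrow i j -> zero_arrow i j.+1.
Proof.
move=> jp z; have jp' : (0 < j.+1 < p i)%N by [].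
have Wst : vanish_stable (pred1 (av i j.+1)).
  apply: pred1_stable; first by rewrite (ltnW jp).
  move=> i' n np /eqP; rewrite inner_eq // => /andP[/eqP-> /eqP[->]].
  exact: z.
apply: (arr_zero jp); apply: (serre_stable_arrow Wst (v := av i j.+1)).
- exact: E_sq.
- exact: idem_arr.
- exact: arr_idem.
- by move=> a; apply: arr_mul_inj.
- exact: eqxx.
- apply/vanishP=> _ /eqP->; rewrite -ractMr -(arr_idem jp) -mulrA E_mul.
  by rewrite inner_eq // [_ == j.+1]gtn_eqF // andbF mulr0 ract0r.
- by move=> _ /eqP->; exists 1; rewrite ract1r.
move=> a aK /vanishP/(_ _ (eqxx _)); have [c [a' aE]] := inner_start a jp'.
rewrite -aK aE => e; suff -> : c = 0 by exists (E (av i j.+2) * a'); rewrite scale0r add0r.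
have no := no_return a' jp'.
move: e; rewrite -ractMr mulrDl -mulrA no mulr0 addr0 -scalerAl E_sq ractZr gen_idem eqxx.
by move=> /eqP; rewrite scaler_eq0 (negPf (gen_neq0 _)) orbF => /eqP.
Qed.

(** Otherwise M would map onto the projective simple module at the sink. *)
Lemma nonzero_arm_end : exists i, ~~ zero_arrow i (p i).-1.
Proof.
case: (boolP [exists i, ~~ zero_arrow i (p i).-1]) => [/existsP //|].
rewrite negb_exists => /forallP z; exfalso.
have Wst : vanish_stable (pred1 (av ord0 (p ord0))).
  apply: pred1_stable; first by rewrite p_gt0 leqnn.
  move=> i n np; rewrite (arm_vertex_sink p_gt0 (leqnn (p ord0))) => /eqP.
  rewrite arm_vertex_eq_sink // => /eqP e.
  by have := z i; rewrite -e negbK.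
have sE : av ord0 (p ord0) = sink by rewrite arm_vertex_sink.
rewrite sE in Wst.
apply: (serre_stable_arrow Wst (v := sink) (b := 0) (e' := 0)); rewrite ?mulr0 ?mul0r //.
- by move=> a; rewrite mul0r => <-.
- by rewrite ract0r mem0v.
- by move=> _ /eqP->; exists 1; rewrite ract1r.
move=> a aK /vanishP/(_ _ (eqxx _)); have [c aE] := E_sink_mul a.
rewrite -aK aE => e; suff -> : c = 0 by exists 0; rewrite scale0r mulr0.
move: e; rewrite -ractMr -scalerAl E_sq ractZr gen_idem eqxx.
by move=> /eqP; rewrite scaler_eq0 (negPf (gen_neq0 _)) orbF => /eqP.
Qed.

Definition inner_on i : pred (can_vertex p) := fun u => if u is inr t then tag t == i else false.

Lemma inner_on_av i i' l : (l <= p i')%N ->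
  inner_on i (av i' l) = (i' == i) && (0 < l < p i)%N.
Proof.
move=> lp; have [l0|lp'|lin] := arm_positionP lp.
- by rewrite l0 andbF.
- rewrite lp' arm_vertex_sink //=; case: eqP => // <-.
  by rewrite ltnn andbF.
have [l' e] := inner_exists p_gt0 lin; rewrite e arm_vertex_inner -e /=.
by case: eqP => // <-; rewrite lin.
Qed.

(** The quotient of M by the inner vertices of the arm i is generated at the source,
    thanks to the arm i0. It is the cokernel of the first arrow of the arm i, since
    modulo the path along this arm all the others are multiples of the one along
    the arm i0. *)
Lemma zero_arrow_first i i0 : i0 != i -> zero_arrow i (p i).-1 ->
    (forall j l, j != i -> (l < p j)%N -> ~~ zero_arrow j l) -> zero_arrow i 0.
Proof.
move=> i0i zlast nz; pose W : pred (can_vertex p) := fun u => ~~ inner_on i u.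
have Wav i' l : (l <= p i')%N -> W (av i' l) = ~~ ((i' == i) && (0 < l < p i)%N).
  by move=> lp; rewrite /W inner_on_av.
have zarm l : (l < p i)%N -> ract M (seg i l (p i)) = 0.
  move=> lp; apply: (@zero_arrow_seg _ (p i).-1) => //.
  by rewrite -ltnS !prednK // lp leqnn.
have nzarm j l : j != i -> (l <= p j)%N ->
    exists2 c, c != 0 & gen source |> seg j 0 l = c *: gen (av j l).
  move=> ji lp; apply: (@act_segment j 0 l); first by rewrite lp.
  by move=> q /andP[_ ql]; apply: nz => //; apply: leq_trans lp.
have Wst : vanish_stable W.
  move=> i' l n /andP[ln np]; rewrite !Wav ?(leq_trans ln) // negbK.
  move=> + /andP[/eqP ei /andP[l0 lp]]; subst i'.
  rewrite eqxx /= (leq_trans l0 ln) /= -leqNgt => pn.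
  have -> : n = p i by apply/eqP; rewrite eqn_leq np.
  exact: zarm.
have genE c v : c *: gen v = 0 -> c = 0.
  by move=> /eqP; rewrite scaler_eq0 (negPf (gen_neq0 _)) orbF => /eqP.
have p0 := p_gt0 i.
apply: (arr_zero p0); apply: (serre_stable_arrow Wst (v := source)).
- exact: E_sq.
- exact: (idem_arr p0).
- exact: arr_idem.
- by move=> a; apply: arr_mul_inj.
- by [].
- have [p1|p1] := ltnP 1 (p i); last first.
    have e : (p i).-1 = 0 by apply/eqP; rewrite -leqn0 -ltnS prednK.
    by move: zlast; rewrite e => /eqP->; rewrite zero_lfunE mem0v.
  apply/vanishP=> u Wu; rewrite -ractMr -(arr_idem p0) -mulrA E_mul.
  case: eqP => [e|_]; last by rewrite mulr0 ract0r.
  by rewrite -e Wav // eqxx p1 in Wu.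
- move=> u; have [i' [l [lp ->]]] := arm_vertex_onto p_gt0 u; rewrite Wav // => Wl.
  case: (eqVneq i' i) Wl => [ei|ni] /= Wl; last first.
    have [c c0 e] := nzarm _ _ ni lp.
    by exists (c^-1 *: seg i' 0 l); rewrite ractZr e scalerA mulVf ?scale1r.
  subst i'; case: (posnP l) Wl => [->|l0] /= Wl; first by exists 1; rewrite ract1r.
  rewrite -leqNgt in Wl; have [c c0 e] := nzarm _ _ i0i (leqnn _).
  exists (c^-1 *: arm i0); rewrite ractZr e scalerA mulVf // scale1r.
  by rewrite !arm_vertex_sink.
move=> a aK /vanishP aW.
suff H v : exists a', E source * a * E v = arr i 0 * a'.
  rewrite -[a]mulr1 -E_sum mulr_sumr; elim/big_rec: _ => [|v b _ [b' ->]].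
    by exists 0; rewrite mulr0.
  have [a' e] := H v; rewrite aK in e.
  by exists (a' + b'); rewrite mulrDr e.
have aW' v' : W v' -> gen source |> (E source * a * E v') = 0.
  by move=> Wv; rewrite aK ractMr aW.
have [i' [l [lp ->]]] := arm_vertex_onto p_gt0 v.
have [->|->|lin] := arm_positionP lp.
- have := aW' source isT; have [c] := mul_E_source (E source * a) => ->.
  rewrite ractZr gen_idem eqxx => /genE ->; exists 0.
  by rewrite scale0r mulr0.
- rewrite arm_vertex_sink //; have := aW' sink isT.
  have [c [d ->]] := source_sink a.
  have [c' [d' ->]] := arm_span i0i ord0.
  have [c'' [d'' ->]] := arm_span i0i (lift ord0 ord0).
  rewrite !scalerDr !scalerA addrACA -!scalerDl.
  rewrite ractDr !ractZr {2}/arm zarm // zero_lfunE scaler0 addr0.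
  have [x x0 ->] := nzarm _ _ i0i (leqnn _); rewrite scalerA => /genE/eqP.
  rewrite mulf_eq0 (negPf x0) orbF => /eqP->; rewrite scale0r add0r.
  exists ((c * d' + d * d'') *: seg i 1 (p i)).
  by rewrite -scalerAr /arm seg_cons ?leqnn ?p0.
have [c e] := source_inner a lin; rewrite e.
have [ei|ni] := eqVneq i' i.
  subst i'; exists (c *: seg i 1 l); rewrite -scalerAr seg_cons //.
  by have/andP[-> _] := lin.
have := aW' (av i' l); rewrite Wav // (negPf ni) => /(_ isT); rewrite e ractZr.
have [x x0 ->] := nzarm _ _ ni lp; rewrite scalerA => /genE/eqP.
by rewrite mulf_eq0 (negPf x0) orbF => /eqP->; exists 0; rewrite scale0r mulr0.
Qed.

Definition zero_arm i := zero_arrow i (p i).-1.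

Lemma zero_arrow_le i j n : (j <= n < p i)%N -> zero_arrow i j -> zero_arrow i n.
Proof.
case/andP; elim: n => [|n IHn] jn np zj; first by move: jn; rewrite leqn0 => /eqP<-.
move: jn; rewrite leq_eqVlt => /predU1P[<- //|jn].
by apply: zero_arrow_next => //; apply: IHn zj => //; apply: ltnW.
Qed.

Lemma nonzero_armP i : ~~ zero_arm i -> forall j, (j < p i)%N -> ~~ zero_arrow i j.
Proof.
move=> nz j jp; apply: contra nz; apply: zero_arrow_le.
by rewrite -ltnS prednK // jp leqnn.
Qed.

Lemma nonzero_arm_act i l : ~~ zero_arm i -> (l <= p i)%N ->
  exists2 c, c != 0 & gen source |> seg i 0 l = c *: gen (av i l).
Proof.
move=> nz lp; apply: (@act_segment i 0 l); first by rewrite lp.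
by move=> j /andP[_ jl]; apply: (nonzero_armP nz); apply: leq_trans lp.
Qed.

(** The path along a nonzero arm would be a combination of two paths which act by
    zero. *)
Lemma zero_arm_unique i j : zero_arm i -> zero_arm j -> i = j.
Proof.
move=> zi zj; apply/eqP/negPn/negP => ij; have [i0 nz] := nonzero_arm_end.
have zarm l : zero_arm l -> gen source |> arm l = 0.
  move=> zl; rewrite /arm (@zero_arrow_seg _ (p l).-1) ?zero_lfunE //=.
  by rewrite prednK.
have [c c0 e] := nonzero_arm_act nz (leqnn _).
have [d [d' e']] := arm_span ij i0.
have : c *: gen (av i0 (p i0)) = 0.
  by rewrite -e -[seg _ _ _]/(arm i0) e' ractDr !ractZr !zarm // !scaler0 addr0.
by move/eqP; rewrite scaler_eq0 (negPf c0) (negPf (gen_neq0 _)).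
Qed.

Lemma zero_armP i : zero_arm i -> forall j, (j < p i)%N -> zero_arrow i j.
Proof.
move=> zi j jp; have [i0 nz] := nonzero_arm_end.
have i0i : i0 != i by apply: contra nz => /eqP->.
apply: (@zero_arrow_le i 0); first exact: jp.
apply: (zero_arrow_first i0i zi) => j' l j'i; apply: nonzero_armP.
by apply: contra j'i => zj'; apply/eqP/zero_arm_unique.
Qed.

(** * The decomposition of M *)

(** The vertices with a given label support a direct summand of M. *)
Definition label (u : can_vertex p) : can_vertex p :=
  if u is inr t then (if zero_arm (tag t) then u else sink) else sink.

Lemma labelK u : label (label u) = label u.
Proof. by case: u => //= t; case: ifP => //= ->. Qed.

Lemma label_sink u : label u = sink ->
  exists i l, [/\ (l <= p i)%N, ~~ zero_arm i & u = av i l].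
Proof.
case: u => [[]|[i l]] /=.
- move=> _; have [i nz] := nonzero_arm_end; exists i, (p i).
  by rewrite leqnn arm_vertex_sink.
- by move=> _; have [i nz] := nonzero_arm_end; exists i, 0.
case: ifP => // /negbT nz _; exists i, l.+1; rewrite arm_vertex_inner; split=> //.
exact: leq_trans (ltn_ord l) (leq_pred _).
Qed.

Lemma label_nonzero_arm i l : (l <= p i)%N -> ~~ zero_arm i -> label (av i l) = sink.
Proof.
move=> lp nz; have [->|->|lin] := arm_positionP lp.
- by [].
- by rewrite arm_vertex_sink.
have [l' ->] := inner_exists p_gt0 lin; rewrite arm_vertex_inner /=.
by rewrite (negPf nz).
Qed.

Lemma label_stable w : vanish_stable (fun u => label u != w).
Proof.
move=> i l n /andP[ln np]; rewrite negbK => nw /eqP lw.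
have [zi|nz] := boolP (zero_arm i); last first.
  by rewrite label_nonzero_arm // -lw label_nonzero_arm ?eqxx // (leq_trans ln) in nw.
move: ln; rewrite leq_eqVlt => /predU1P[e|ln]; first by rewrite -e lw eqxx in nw.
apply: (@zero_arrow_seg i l); rewrite ?leqnn //.
exact/(zero_armP zi)/(leq_trans ln).
Qed.

Definition piece w : submodule M := vanish_sub (@label_stable w).

Lemma pieceP w y : reflect (forall u, label u != w -> y |> E u = 0) (y \in piece w).
Proof. exact: vanishP. Qed.

Lemma piece_gen u : gen u \in piece (label u).
Proof. by rewrite /= vanish_gen negbK. Qed.

Lemma source_reach u : label u = sink -> exists a, gen u = gen source |> a.
Proof.
case/label_sink=> i [l [lp nz ->]]; have [c c0 e] := nonzero_arm_act nz lp.
by exists (c^-1 *: seg i 0 l); rewrite ractZr e scalerA mulVf ?scale1r.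
Qed.

Lemma sink_reach u : label u = sink -> exists a, gen u |> a |> E sink != 0.
Proof.
case/label_sink=> i [l [lp nz ->]]; exists (seg i l (p i)).
have [|j /andP[_ jp]|c c0 ->] := @act_segment i l (p i); first by rewrite lp leqnn.
  exact: (nonzero_armP nz).
by rewrite lfunZ arm_vertex_sink // gen_idem eqxx scaler_eq0 (negPf c0) gen_neq0.
Qed.

Lemma dim_piece w u : \dim (limg (ract (submod (piece w)) (E u))) = (label u == w).
Proof.
case: eqP => [<-|/eqP lu]; last first.
  suff -> : ract (submod (piece w)) (E u) = 0 by rewrite lim0g dimv0.
  apply/lfunP=> y; rewrite zero_lfunE; apply: subvs_inj; rewrite vsval_act linear0.
  by have /pieceP := subvsP y; apply.
have -> : limg (ract (submod (piece (label u))) (E u)) = <[vsproj (piece (label u)) (gen u)]>%VS.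
  apply/eqP; rewrite eqEsubv; apply/andP; split; apply/subvP=> y.
    case/memv_imgP=> z _ ->; have [c e] := act_idem (vsval z) u.
    apply/vlineP; exists c; apply: subvs_inj.
    by rewrite vsval_act e linearZ /= vsprojK ?piece_gen.
  case/vlineP=> c ->; apply/memvZ/memv_imgP.
  exists (vsproj (piece (label u)) (gen u)); rewrite ?memvf //; apply: subvs_inj.
  by rewrite vsval_act vsprojK ?piece_gen // gen_idem eqxx.
rewrite dim_vline; congr (nat_of_bool _); apply: contraTneq isT => e.
have := congr1 vsval e; rewrite vsprojK ?piece_gen // linear0.
by move/eqP; rewrite (negPf (gen_neq0 _)).
Qed.

(** The piece of an inner vertex is simple. In the piece of the sink, a submodule
    which is nonzero at the source is everything, by source_reach; and a nonzero
    submodule is nonzero at the sink, by sink_reach. *)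
Lemma piece_simple w : label w = w -> regular_simple E (ones p) (submod (piece w)).
Proof.
move=> lw; split.
- apply/eqP=> z; have := dim_piece w w; rewrite lw eqxx.
  suff -> : limg (ract (submod (piece w)) (E w)) = 0%VS by rewrite dimv0.
  by rewrite z limg0.
- have := euler_form_ones (submod (piece w)); rewrite !dim_piece.
  by rewrite [label source]/= [label sink]/= subrr.
move=> V V0 V1; eexists; first exact: euler_form_ones.
(* As M is a line at u, a submodule that is nonzero at u contains gen u. *)
have genV (y : submod (piece w)) u c : vsval y |> E u = c *: gen u -> c != 0 ->
    y \in (V : {vspace _}) -> vsproj (piece w) (gen u) \in (V : {vspace _}).
  move=> e c0 yV; suff -> : vsproj (piece w) (gen u) = y |> (c^-1 *: E u) by apply: sub_stable.
  apply: subvs_inj; rewrite vsval_act ractZr e scalerA mulVf // scale1r vsprojK //.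
  have -> : gen u = c^-1 *: (vsval y |> E u) by rewrite e scalerA mulVf ?scale1r.
  by apply: memvZ; apply: sub_stable; apply: subvsP.
have [y yV y0] : exists2 y, y \in (V : {vspace _}) & y != 0.
  by exists (vpick V); rewrite ?memv_pick // vpick0.
have [u [c [e c0 lu]]] : exists u c, [/\ vsval y |> E u = c *: gen u, c != 0 & label u = w].
  have [/forallP z|] := boolP [forall u, vsval y |> E u == 0].
    case/eqP: y0; apply: subvs_inj; rewrite [vsval y]act_sum big1 ?linear0 // => u _.
    exact/eqP.
  rewrite negb_forall => /existsP[u nz]; have [c e] := act_idem (vsval y) u.
  exists u, c; split=> //; first by apply: contra_neq nz => c0; rewrite e c0 scale0r.
  apply/eqP; apply: contraNT nz => lu.
  by have /pieceP/(_ u lu)-> := subvsP y.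
have guV := genV _ _ _ e c0 yV.
have fullV : (forall u', label u' = w -> vsproj (piece w) (gen u') \in (V : {vspace _})) -> False.
  move=> h; case/eqP: V1; apply/eqP; rewrite eqEsubv subvf; apply/subvP=> z _.
  rewrite -[z]ract1r -E_sum ract_sumr memv_suml // => u' _.
  have [lu'|nlu] := eqVneq (label u') w; last first.
    suff -> : z |> E u' = 0 by apply: mem0v.
    by apply: subvs_inj; rewrite vsval_act linear0; have /pieceP := subvsP z; apply.
  have [d zE] := act_idem (vsval z) u'.
  suff -> : z |> E u' = d *: vsproj (piece w) (gen u') by rewrite memvZ // h.
  apply: subvs_inj; rewrite vsval_act zE linearZ /= vsprojK //.
  by rewrite -lu' piece_gen.
have [ws|nws] := eqVneq w sink; last first.
  exfalso; apply: fullV => u' lu'; suff -> : u' = u by [].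
  have lab (v : can_vertex p) : label v = w -> v = w.
    case: v => [b|t] /=; first by move=> e1; rewrite -e1 eqxx in nws.
    by case: ifP => // _ e1; rewrite -e1 eqxx in nws.
  by rewrite (lab _ lu') (lab _ lu).
have source0 : ract (submod V) (E source) = 0.
  apply/lfunP=> z; rewrite zero_lfunE; apply: subvs_inj; rewrite vsval_act linear0.
  apply: subvs_inj; rewrite vsval_act linear0.
  have [d zE] := act_idem (vsval (vsval z)) source; rewrite zE.
  have [->|d0] := eqVneq d 0; first exact: scale0r.
  exfalso; apply: fullV => u' lu'; rewrite ws in lu'.
  have sV := genV _ _ _ zE d0 (subvsP z).
  have [a uE] := source_reach lu'.
  suff -> : vsproj (piece w) (gen u') = (vsproj (piece w) (gen source) : submod (piece w)) |> a.
    exact: sub_stable.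
  apply: subvs_inj; rewrite vsval_act !vsprojK //; first by rewrite ws (piece_gen source).
  by rewrite ws -lu' piece_gen.
have sink_gt0 : (0 < \dim (limg (ract (submod V) (E sink))))%N.
  rewrite ws in lu; have [a ua] := sink_reach lu.
  rewrite lt0n dimv_eq0; apply: contra_neq ua => z.
  pose g : submod V := vsproj V (vsproj (piece w) (gen u)).
  have gE : vsval (vsval g) = gen u by rewrite !vsprojK // ws -lu piece_gen.
  have : g |> a |> E sink \in limg (ract (submod V) (E sink)) by rewrite memv_img ?memvf.
  by rewrite z memv0 => /eqP e0; rewrite -gE -!vsval_act e0 !linear0.
rewrite source0 lim0g dimv0 sub0r.
by case: (\dim _) sink_gt0.
Qed.

Theorem serre_stable_regular_semisimple : regular_semisimple E (ones p) M.
Proof.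
pose J := [pred w | label w == w]; pose V (i : 'I_#|J|) : submodule M := piece (enum_val i).
have lJ (i : 'I_#|J|) : label (enum_val i) = enum_val i by apply/eqP/(enum_valP i).
exists #|J|, V; split.
- apply/directv_sum_independent => us usV us0 i _.
  rewrite [us i]act_sum big1 // => u _.
  have [lu|nlu] := eqVneq (label u) (enum_val i); last first.
    by have /pieceP := usV i isT; apply.
  have := congr1 (fun y => y |> E u) us0; rewrite /= lfun0 linear_sum (bigD1 i) //=.
  rewrite big1 ?addr0 // => j ji; have /pieceP := usV j isT; apply.
  by rewrite lu (inj_eq enum_val_inj) eq_sym.
- apply/eqP; rewrite eqEsubv subvf; apply/subvP=> y _.
  rewrite [y]act_sum memv_suml // => u _; have [c ->] := act_idem y u.
  have luJ : label u \in J by rewrite inE labelK.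
  apply: memvZ; apply: (subvP (sumv_sup (enum_rank_in luJ (label u)) isT (subvv _))).
  by rewrite /V enum_rankK_in // piece_gen.
by move=> i; apply: piece_simple.
Qed.

End SerreStable.
End OnesModule.
End CanonicalAlgebra.

Theorem proposition5p6 (k : closedFieldType) (char_k : [pchar k] =i pred0)
    (m : nat) (p : 'I_m.+2 -> nat) (p_gt0 : forall i, (0 < p i)%N)
    (lam : 'I_m -> k) (lam_neq0 : forall i, lam i != 0)
    (lam_inj : injective lam)
    (A : falgType k)
    (pi : {lrmorphism path_algebra k (canonical_quiver p) -> A})
    (A_canonical : is_canonical_algebra lam pi)
    (M : rmodule A)
    (M_ones : dim_vector (vertex_idem pi) M = ones p)
    (M_serre_stable : serre_stable M) :
  regular_semisimple (vertex_idem pi) (ones p) M.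
Proof.
exact: (serre_stable_regular_semisimple p_gt0 lam_neq0 lam_inj A_canonical
  M_ones M_serre_stable).
Qed.
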